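(* Let $\mathbb{H}$ be the graded affine Hecke algebra attached to a root system $\Phi\subset V$ and a real parameter function $k$, let $S$ be a spin module, and let $(\pi,X)$ be a one $W$-type $\mathbb{H}$-module. Then the Dirac cohomology of $X$ with respect to $S$ is $H^D(X)=X\otimes S$.
   Context: $V$ is a finite-dimensional Euclidean space with inner product $(\ ,\ )$. $\Phi\subset V\setminus\{0\}$ is a finite reduced root system: $\Phi$ spans $V$; for $\alpha\in\Phi$ the reflection $s_\alpha(v)=v-\frac{2(\alpha,v)}{(\alpha,\alpha)}\alpha$ preserves $\Phi$; and $\alpha\in\Phi$ implies $2\alpha\notin\Phi$. $W\subset O(V)$ is the finite group generated by the $s_\alpha$, $\Phi^+$ a system of positive roots, $\Pi$ the simple roots, $w_0$ the longest element of $W$. $k:\Phi^+\to\mathbb{R}$, $\alpha\mapsto k_\alpha$, is $W$-invariant. $V_{\mathbb{C}}=V\otimes_{\mathbb R}\mathbb{C}$. The graded affine Hecke algebra $\mathbb{H}$ is the unital associative $\mathbb{C}$-algebra generated by $\{t_w:w\in W\}$ and $\{\omega\in V_{\mathbb{C}}\}$ (linear in $\omega$) with relations $t_wt_{w'}=t_{ww'}$; $\omega\omega'=\omega'\omega$; and $\omega t_{s_\alpha}-t_{s_\alpha}s_\alpha(\omega)=k_\alpha\frac{\omega-s_\alpha(\omega)}{\alpha}$ for $\alpha\in\Pi$, $\omega\in V_{\mathbb C}$, where $\frac{\omega-s_\alpha(\omega)}{\alpha}$ is the scalar $\frac{2(\alpha,\omega)}{(\alpha,\alpha)}$ (with $(\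 ,\ )$ extended bilinearly). $*$ is the conjugate-linear anti-involution of $\mathbb{H}$ with $t_w^*=t_{w^{-1}}$ for $w\in W$ and $\omega^*=-t_{w_0}\,w_0(\omega)\,t_{w_0}$ for $\omega\in V$. An $\mathbb{H}$-module $(\pi,X)$ is $*$-hermitian if $X$ has a nondegenerate hermitian form with $\langle\pi(h)x,y\rangle=\langle x,\pi(h^* )y\rangle$ for all $h\in\mathbb{H}$, $x,y\in X$. A one $W$-type module is a simple $*$-hermitian $\mathbb{H}$-module whose restriction to $\mathbb{C}[W]$ is irreducible. For $\omega\in V$, $\widetilde\omega=\frac12(\omega-\omega^* )\in\mathbb{H}$. $C(V)$ is the real Clifford algebra generated by $V$ with $v_1v_2+v_2v_1=-2(v_1,v_2)$. A spin module $S$ is a simple complex $C(V)$-module (unique up to isomorphism if $\dim V$ is even; two, $S^+$ and $S^-$, if $\dim V$ is odd). The Dirac element is $\mathcal{D}=\sum_i\widetilde\omega_i\otimes\omega_i\in\mathbb{H}\otimes C(V)$ for an orthonormal basis $\{\omega_i\}$ of $V$ (independent of the basis). Its left action on $X\otimes S$ is the Dirac operator $D_X:X\otimes S\to X\otimes S$, and the Dirac cohomology is $H^D(X)=\ker D_X/(\ker D_X\cap\operatorname{im}D_X)$. *)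

(* Defs.v *)
From HB Require Import structures.
From mathcomp Require Import all_boot all_order all_algebra.
From mathcomp Require Import sesquilinear ring_quotient generic_quotient complex.
From mathcomp Require Import boolp reals.
From mathcomp Require finmap.
From mathcomp Require Import monalg freeg.

Set Implicit Arguments.
Unset Strict Implicit.
Unset Printing Implicit Defensive.

Import Order.TTheory GRing.Theory Num.Theory.
Local Open Scope ring_scope.
Local Open Scope quotient_scope.

Section QuotientModule.
Variables (K : nzRingType) (M : lmodType K) (N : submodClosed M).

(* The library's submodClosed does not entail zmodClosed. *)
Definition submod_pred : {pred M} := N.

Lemma submod_pred_zmod : zmod_closed submod_pred.
Proof.
split=> [|x y hx hy]; first exact: (rpred0 N).
by rewrite /submod_pred -scaleN1r; apply: (rpredD hx); apply: rpredZ.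
Qed.

HB.instance Definition _ :=
  GRing.isZmodClosed.Build M submod_pred submod_pred_zmod.

Definition quotmod : Type := Quotient.quot submod_pred.
HB.instance Definition _ := GRing.Zmodule.on quotmod.

Definition quotmod_class (x : M) : quotmod := \pi_(Quotient.quot submod_pred) x.

Lemma quotmod_classK (u : quotmod) : quotmod_class (repr u) = u.
Proof. by rewrite /quotmod_class reprK. Qed.

Lemma quotmod_eqP (x y : M) :
  (quotmod_class x = quotmod_class y) <-> (x - y \in N).
Proof.
rewrite -[_ \in N]/(_ \in submod_pred) Quotient.idealrBE.
by split=> [/eqP | /eqP].
Qed.

Lemma quotmod_classD (x y : M) :
  quotmod_class (x + y) = quotmod_class x + quotmod_class y.
Proof. by rewrite /quotmod_class raddfD. Qed.

Definition quotmod_scale (c : K) (u : quotmod) : quotmod :=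
  quotmod_class (c *: repr u).

Lemma quotmod_scaleE (c : K) (x : M) :
  quotmod_scale c (quotmod_class x) = quotmod_class (c *: x).
Proof.
apply/quotmod_eqP; rewrite -scalerBr rpredZ //.
by apply/quotmod_eqP; rewrite quotmod_classK.
Qed.

Lemma quotmod_scaleA a b u :
  quotmod_scale a (quotmod_scale b u) = quotmod_scale (a * b) u.
Proof. by rewrite -[u]quotmod_classK !quotmod_scaleE scalerA. Qed.

Lemma quotmod_scale1 : left_id 1 quotmod_scale.
Proof. by move=> u; rewrite -[u]quotmod_classK quotmod_scaleE scale1r. Qed.

Lemma quotmod_scaleDr : right_distributive quotmod_scale +%R.
Proof.
move=> a u v; rewrite -[u]quotmod_classK -[v]quotmod_classK.
by rewrite -quotmod_classD !quotmod_scaleE scalerDr quotmod_classD.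
Qed.

Lemma quotmod_scaleDl u : {morph quotmod_scale^~ u : a b / a + b}.
Proof.
move=> a b; rewrite -[u]quotmod_classK !quotmod_scaleE.
by rewrite scalerDl quotmod_classD.
Qed.

HB.instance Definition _ := GRing.Zmodule_isLmodule.Build K quotmod
  quotmod_scaleA quotmod_scale1 quotmod_scaleDr quotmod_scaleDl.

Lemma quotmod_class_linear : linear quotmod_class.
Proof.
by move=> c x y; rewrite quotmod_classD -quotmod_scaleE.
Qed.

HB.instance Definition _ :=
  GRing.isLinear.Build K M quotmod _ quotmod_class quotmod_class_linear.

End QuotientModule.

Section Tensor.
Variables (K : fieldType) (X Y : lmodType K).

Local Notation free := {freeg (X * Y) / K}.
Local Notation gen x y := ([freeg [:: (1, (x, y))]] : free).

Inductive tensor_span : free -> Prop :=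
| tensor_span0 : tensor_span 0
| tensor_spanP c u v :
    tensor_span u -> tensor_span v -> tensor_span (c *: u + v)
| tensor_spanl c x x' y :
    tensor_span (gen (c *: x + x') y - (c *: gen x y + gen x' y))
| tensor_spanr c x y y' :
    tensor_span (gen x (c *: y + y') - (c *: gen x y + gen x y')).

Definition tensor_rel : {pred free} := [pred u | `[< tensor_span u >]].

Lemma tensor_rel_submod : submod_closed tensor_rel.
Proof.
split=> [|c u v]; rewrite !inE; first exact/asboolP/tensor_span0.
by move=> /asboolP hu /asboolP hv; apply/asboolP/tensor_spanP.
Qed.

HB.instance Definition _ :=
  GRing.isSubmodClosed.Build K free tensor_rel tensor_rel_submod.

Definition tensor : Type := quotmod tensor_rel.
HB.instance Definition _ := GRing.Lmodule.on tensor.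

Definition tens (x : X) (y : Y) : tensor := quotmod_class tensor_rel (gen x y).

End Tensor.

Section TensorTheory.
Variables (K : fieldType) (X Y : lmodType K).

Lemma tensDl c (x x' : X) (y : Y) :
  tens (c *: x + x') y = c *: tens x y + tens x' y.
Proof.
rewrite /tens -linearP; apply/quotmod_eqP; rewrite inE; apply/asboolP.
exact: tensor_spanl.
Qed.

Lemma tensDr c (x : X) (y y' : Y) :
  tens x (c *: y + y') = c *: tens x y + tens x y'.
Proof.
rewrite /tens -linearP; apply/quotmod_eqP; rewrite inE; apply/asboolP.
exact: tensor_spanr.
Qed.

End TensorTheory.

Lemma fglift_linear (K : nzRingType) (G : choiceType) (M : lmodType K)
  (f : G -> M) : linear (fglift f).
Proof.
pose F := GRing.isZmodMorphism.Build _ _ (fglift f) (lift_is_additive f).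
pose g : {additive {freeg G / K} -> M} := HB.pack (fglift f) F.
move=> c u v; rewrite -[LHS]/(g _) raddfD /=; congr (_ + _).
rewrite -[fglift f u]/(g u) -[in RHS](freeg_sumE u) raddf_sum scaler_sumr.
rewrite -[fglift f _]/(g _) -[c *: u]/(fgscale c u) raddf_sum.
by apply: eq_bigr => x _; rewrite /= !liftU scalerA.
Qed.

Section TensorMap.
Variables (K : fieldType) (X X' Y Y' : lmodType K).
Variables (f : {linear X -> X'}) (g : {linear Y -> Y'}).

Local Notation lift :=
  (fglift (fun p : X * Y => tens (f p.1) (g p.2))).

Definition tensor_map (z : tensor X Y) : tensor X' Y' := lift (repr z).

Lemma tensor_lift0 u : tensor_span u -> lift u = 0.
Proof.
have L c v w : lift (c *: v + w) = c *: lift v + lift w.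
  exact: fglift_linear.
have L0 : lift 0 = 0 by have := L (-1) 0 0; rewrite !scaleN1r oppr0 addNr addr0.
have LB v w : lift (v - w) = lift v - lift w.
  have -> : v - w = (-1) *: w + v by rewrite scaleN1r addrC.
  by rewrite L scaleN1r addrC.
elim=> [|c v w _ hv _ hw|c x x' y|c x y y'].
- exact: L0.
- by rewrite L hv hw scaler0 addr0.
- by rewrite LB L !liftU !scale1r /= linearP tensDl subrr.
- by rewrite LB L !liftU !scale1r /= linearP tensDr subrr.
Qed.

Lemma tensor_map_class u :
  tensor_map (quotmod_class (@tensor_rel K X Y) u) = lift u.
Proof.
have L c v w : lift (c *: v + w) = c *: lift v + lift w.
  exact: fglift_linear.
rewrite /tensor_map; set v := repr _.
have vE : v = 1 *: (v - u) + u by rewrite scale1r subrK.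
rewrite vE L tensor_lift0 ?scaler0 ?add0r //; apply/asboolP.
have /quotmod_eqP := quotmod_classK (quotmod_class (@tensor_rel K X Y) u).
by rewrite inE.
Qed.

Lemma tensor_mapE x y : tensor_map (tens x y) = tens (f x) (g y).
Proof. by rewrite tensor_map_class liftU scale1r. Qed.

Lemma tensor_map_linear : linear tensor_map.
Proof.
move=> c u v; rewrite -[u]quotmod_classK -[v]quotmod_classK -linearP.
by rewrite !tensor_map_class fglift_linear.
Qed.

HB.instance Definition _ :=
  GRing.isLinear.Build K (tensor X Y) (tensor X' Y') _ tensor_map
    tensor_map_linear.

End TensorMap.

Section TensorMapSum.
Variables (K : fieldType) (X Y : lmodType K) (J : Type) (r : seq J).
Variables (f : J -> {linear X -> X}) (g : J -> {linear Y -> Y}).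

Definition tensor_map_sum (z : tensor X Y) : tensor X Y :=
  \sum_(j <- r) tensor_map (f j) (g j) z.

Lemma tensor_map_sum_linear : linear tensor_map_sum.
Proof.
move=> c y z; rewrite /tensor_map_sum scaler_sumr -big_split /=.
by apply: eq_bigr => j _; rewrite tensor_map_linear.
Qed.

HB.instance Definition _ :=
  GRing.isLinear.Build K (tensor X Y) (tensor X Y) _ tensor_map_sum
    tensor_map_sum_linear.

End TensorMapSum.

Lemma malg_scalerAr (K : fieldType) (G : monomType) c (a b : {malg K[G]}) :
  c *: (a * b) = a * (c *: b).
Proof.
apply/malgP => k; rewrite mcoeffZ mcoeffMl.
rewrite (mcoeffMlw _ (finmap.fsubset_refl _) (msuppZ_le c b)) mulr_sumr.
apply: eq_bigr => x _; rewrite mulr_sumr; apply: eq_bigr => y _.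
by rewrite mcoeffZ mulrnAr mulrCA.
Qed.

Section PresentedAlgebra.
Variables (K : fieldType) (I : choiceType).

Definition free_alg : Type := {malg K[{fmonom I}]}.
HB.instance Definition _ := GRing.Lalgebra.on free_alg.

Definition free_gen (i : I) : free_alg := mkmalgU (fmu i) 1.

Variable rel : free_alg -> Prop.

Inductive ideal_gen : free_alg -> Prop :=
| ideal_rel a : rel a -> ideal_gen a
| ideal0 : ideal_gen 0
| idealP c a b : ideal_gen a -> ideal_gen b -> ideal_gen (c *: a + b)
| idealMl a b : ideal_gen b -> ideal_gen (a * b)
| idealMr a b : ideal_gen a -> ideal_gen (a * b).

Definition ideal_pred : {pred free_alg} := [pred a | `[< ideal_gen a >]].

Lemma ideal_pred_submod : submod_closed ideal_pred.
Proof.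
split=> [|c u v]; rewrite !inE; first exact/asboolP/ideal0.
by move=> /asboolP hu /asboolP hv; apply/asboolP/idealP.
Qed.

HB.instance Definition _ :=
  GRing.isSubmodClosed.Build K free_alg ideal_pred ideal_pred_submod.

Definition presented : Type := quotmod ideal_pred.
HB.instance Definition _ := GRing.Lmodule.on presented.

Definition presented_class (a : free_alg) : presented :=
  quotmod_class ideal_pred a.

Definition presented_mul (a b : presented) : presented :=
  presented_class (repr a * repr b).

Lemma presented_classK a : presented_class (repr a) = a.
Proof. exact: quotmod_classK. Qed.

Lemma presented_eqP a b :
  (presented_class a = presented_class b) <-> ideal_gen (a - b).
Proof.
rewrite /presented_class; split=> [/quotmod_eqP|h].
  by rewrite inE => /asboolP.
by apply/quotmod_eqP; rewrite inE; apply/asboolP.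
Qed.

Lemma presented_mulE a b :
  presented_mul (presented_class a) (presented_class b) =
  presented_class (a * b).
Proof.
have ha : ideal_gen (repr (presented_class a) - a).
  by apply/presented_eqP; rewrite presented_classK.
have hb : ideal_gen (repr (presented_class b) - b).
  by apply/presented_eqP; rewrite presented_classK.
set a' := repr _ in ha *; set b' := repr _ in hb *.
apply/presented_eqP.
have -> : a' * b' - a * b = 1 *: ((a' - a) * b') + a * (b' - b).
  by rewrite scale1r mulrBl mulrBr addrA subrK.
by apply: idealP; [apply: idealMr | apply: idealMl].
Qed.

Lemma presented_classD a b :
  presented_class (a + b) = presented_class a + presented_class b.
Proof. exact: quotmod_classD. Qed.

Lemma presented_mulA : associative presented_mul.
Proof.
move=> a b c; rewrite -[a]presented_classK -[b]presented_classK.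
by rewrite -[c]presented_classK !presented_mulE mulrA.
Qed.

Lemma presented_mul1 : left_id (presented_class 1) presented_mul.
Proof. by move=> a; rewrite -[a]presented_classK presented_mulE mul1r. Qed.

Lemma presented_mulr1 : right_id (presented_class 1) presented_mul.
Proof. by move=> a; rewrite -[a]presented_classK presented_mulE mulr1. Qed.

Lemma presented_mulDl : left_distributive presented_mul +%R.
Proof.
move=> a b c; rewrite -[a]presented_classK -[b]presented_classK.
rewrite -[c]presented_classK -presented_classD !presented_mulE mulrDl.
exact: presented_classD.
Qed.

Lemma presented_mulDr : right_distributive presented_mul +%R.
Proof.
move=> a b c; rewrite -[a]presented_classK -[b]presented_classK.
rewrite -[c]presented_classK -presented_classD !presented_mulE mulrDr.
exact: presented_classD.
Qed.

HB.instance Definition _ := GRing.Zmodule_isPzRing.Build presented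
  presented_mulA presented_mul1 presented_mulr1 presented_mulDl
  presented_mulDr.

Lemma presented_classM a b :
  presented_class (a * b) = presented_class a * presented_class b.
Proof. by rewrite -presented_mulE. Qed.

Lemma presented_class1 : presented_class 1 = 1.
Proof. by []. Qed.

Lemma presented_classZ c a :
  presented_class (c *: a) = c *: presented_class a.
Proof. exact: linearZ. Qed.

Lemma presented_scalerAl c (a b : presented) : c *: (a * b) = (c *: a) * b.
Proof.
rewrite -[a]presented_classK -[b]presented_classK -presented_classM.
by rewrite -!presented_classZ -presented_classM scalerAl.
Qed.

Lemma presented_scalerAr c (a b : presented) : c *: (a * b) = a * (c *: b).
Proof.
rewrite -[a]presented_classK -[b]presented_classK -presented_classM.
rewrite -!presented_classZ -presented_classM; congr presented_class.
exact: malg_scalerAr.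
Qed.

End PresentedAlgebra.

Section Representations.
Variables (K C : fieldType) (iota : {rmorphism K -> C}) (I : choiceType).
Variables (rel : free_alg K I -> Prop) (X : lmodType C).

(* A module over a K-algebra on a C-vector space, K acting through iota. *)
Record representation (act : presented rel -> {linear X -> X}) : Prop :=
  Representation {
    act1 : forall x, act 1 x = x;
    actM : forall a b x, act (a * b) x = act a (act b x);
    actD : forall a b x, act (a + b) x = act a x + act b x;
    actZ : forall c a x, act (c *: a) x = iota c *: act a x
  }.

End Representations.

Definition simple_action (C : fieldType) (X : lmodType C) (J : Type)
    (act : J -> X -> X) : Prop :=
  (exists x : X, x != 0) /\
  forall U : {pred X}, submod_closed U ->
    (forall j x, x \in U -> act j x \in U) ->
    (forall x, x \in U -> x = 0) \/ (forall x, x \in U).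

Section Cohomology.
Variables (K : fieldType) (Y : lmodType K) (D : {linear Y -> Y}).

Definition ker_pred : {pred Y} := [pred y | D y == 0].

Lemma ker_pred_submod : submod_closed ker_pred.
Proof.
split=> [|c x y]; rewrite !inE ?linear0 // => /eqP hx /eqP hy.
by rewrite linearP hx hy scaler0 addr0.
Qed.

HB.instance Definition _ :=
  GRing.isSubmodClosed.Build K Y ker_pred ker_pred_submod.

Definition ker : Type := {y : Y | ker_pred y}.
HB.instance Definition _ := SubChoice.on ker.
HB.instance Definition _ := [SubChoice_isSubLmodule of ker by <:].

Definition im_in_ker : {pred ker} := [pred y | `[< exists z, D z = val y >]].

Lemma im_in_ker_submod : submod_closed im_in_ker.
Proof.
split=> [|c x y]; rewrite !inE.
  by apply/asboolP; exists 0; rewrite !linear0.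
move=> /asboolP[u hu] /asboolP[v hv]; apply/asboolP; exists (c *: u + v).
by rewrite !linearP hu hv.
Qed.

HB.instance Definition _ :=
  GRing.isSubmodClosed.Build K ker im_in_ker im_in_ker_submod.

Definition cohomology : Type := quotmod im_in_ker.
HB.instance Definition _ := GRing.Lmodule.on cohomology.

Definition cohomology_class (y : ker) : cohomology := quotmod_class im_in_ker y.

End Cohomology.

Section Complexification.
Variables (R : realType) (V : lmodType R).

(* (x, y) stands for x + iy *)
Definition cplx : Type := (V * V)%type.
HB.instance Definition _ := GRing.Zmodule.on cplx.

Definition cplx_scale (c : R[i]) (x : cplx) : cplx :=
  (complex.Re c *: x.1 - complex.Im c *: x.2,
   complex.Re c *: x.2 + complex.Im c *: x.1).

Lemma cplx_scaleA a b x : cplx_scale a (cplx_scale b x) = cplx_scale (a * b) x.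
Proof.
case: a b x => [a a'] [b b'] [x y]; rewrite /cplx_scale.
rewrite -[_ * _]/((a * b - a' * b') +i* (a * b' + a' * b))%C /=.
rewrite !scalerDr !scalerDl !scalerN !scaleNr !scalerA.
congr (_, _).
  by rewrite !opprD [X in _ + X = _]addrC addrACA.
by rewrite [X in _ + X = _]addrC addrACA.
Qed.

Lemma cplx_scale1 : left_id 1 cplx_scale.
Proof.
by case=> x y; rewrite /cplx_scale /= !scale1r !scale0r subr0 addr0.
Qed.

Lemma cplx_scaleDr : right_distributive cplx_scale +%R.
Proof.
move=> a [x y] [x' y']; rewrite /cplx_scale /=.
by congr (_, _); rewrite /= !scalerDr ?opprD addrACA.
Qed.

Lemma cplx_scaleDl x : {morph cplx_scale^~ x : a b / a + b}.
Proof.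
move=> [a a'] [b b']; case: x => x y; rewrite /cplx_scale /=.
by congr (_, _); rewrite /= !scalerDl ?opprD addrACA.
Qed.

HB.instance Definition _ := GRing.Zmodule_isLmodule.Build R[i] cplx
  cplx_scaleA cplx_scale1 cplx_scaleDr cplx_scaleDl.

Definition to_cplx (v : V) : cplx := (v, 0).

Definition cplx_map (f : V -> V) (x : cplx) : cplx := (f x.1, f x.2).

End Complexification.

Section RootSystem.
Variables (R : realType) (V : vectType R) (dot : {dot V for idfun}).

Definition refl (a : V) : 'End(V) :=
  linfun (fun v => v - (2 * dot a v / dot a a) *: a).

Lemma refl_linear a : linear (fun v => v - (2 * dot a v / dot a a) *: a).
Proof.
move=> c u v; rewrite linearPr mulrDr mulrDl scalerDl opprD addrACA.
by congr (_ + _); rewrite scalerBr scalerA; congr (_ - _ *: _); rewrite mulrCA !mulrA.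
Qed.

Lemma reflE a v : refl a v = v - (2 * dot a v / dot a a) *: a.
Proof.
pose L := GRing.isLinear.Build R V V *:%R _ (refl_linear a).
by pose f : {linear V -> V} := HB.pack (fun v => v - (2 * dot a v / dot a a) *: a) L;
   rewrite /refl -[linfun _]/(linfun f) lfunE.
Qed.

Definition root_system (Phi : seq V) : Prop :=
  [/\ 0 \notin Phi, <<Phi>>%VS = fullv,
      forall a b, a \in Phi -> b \in Phi -> refl a b \in Phi
    & forall a, a \in Phi -> a *+ 2 \notin Phi].

(* Positive with respect to a regular vector g. *)
Definition positive_system (Phi Phip : seq V) : Prop :=
  exists g : V, (forall a, a \in Phi -> dot g a != 0) /\
    forall a, (a \in Phip) = (a \in Phi) && (0 < dot g a).

(* The basis of V by positive roots of which every positive root is a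
   nonnegative combination; Phi need not be crystallographic. *)
Definition simple_roots (Phip Pi : seq V) : Prop :=
  [/\ basis_of fullv Pi, {subset Pi <= Phip}
    & forall b, b \in Phip ->
        exists2 c : V -> R, (forall a, 0 <= c a) & b = \sum_(a <- Pi) c a *: a].

Inductive in_weyl (Phi : seq V) : 'End(V) -> Prop :=
| in_weyl1 : in_weyl Phi \1%VF
| in_weyl_refl a : a \in Phi -> in_weyl Phi (refl a)
| in_weylM u w : in_weyl Phi u -> in_weyl Phi w -> in_weyl Phi (u \o w)%VF
(* Weyl elements are bijective, so the generic ^-1 is their true inverse. *)
| in_weylV w : in_weyl Phi w -> in_weyl Phi (w^-1)%VF.

Definition weyl (Phi : seq V) : Type := {w : 'End(V) | `[< in_weyl Phi w >]}.
HB.instance Definition _ Phi := SubChoice.on (weyl Phi).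

Section WeylOperations.
Variable Phi : seq V.

Definition weyl1 : weyl Phi := Sub \1%VF (introT (asboolP _) (in_weyl1 Phi)).

Definition weylM (u w : weyl Phi) : weyl Phi :=
  Sub (val u \o val w)%VF (introT (asboolP _)
    (in_weylM (elimT (asboolP _) (valP u)) (elimT (asboolP _) (valP w)))).

Definition weylV (w : weyl Phi) : weyl Phi :=
  Sub ((val w)^-1)%VF
    (introT (asboolP _) (in_weylV (elimT (asboolP _) (valP w)))).

End WeylOperations.

(* Only the values of k on the positive roots are constrained or used. *)
Definition weyl_invariant (Phi Phip : seq V) (k : V -> R) : Prop :=
  forall (w : weyl Phi) a, a \in Phip -> val w a \in Phip -> k (val w a) = k a.

Definition simple_word (s : seq V) : 'End(V) :=
  foldr (fun a w => (refl a \o w)%VF) \1%VF s.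

(* n is the least number of simple reflections with product w. *)
Definition weyl_length (Pi : seq V) (w : 'End(V)) (n : nat) : Prop :=
  (exists s, [/\ {subset s <= Pi}, size s = n & simple_word s = w]) /\
  forall s, {subset s <= Pi} -> simple_word s = w -> (n <= size s)%N.

Definition longest (Phi Pi : seq V) (w0 : weyl Phi) : Prop :=
  exists2 n, weyl_length Pi (val w0) n &
    forall (w : weyl Phi) m, weyl_length Pi (val w) m -> (m <= n)%N.

End RootSystem.

Section Hecke.
Variables (R : realType) (V : vectType R) (dot : {dot V for idfun}).
Variables (Phi Pi : seq V) (k : V -> R).

Local Notation C := R[i].
Local Notation W := (weyl dot Phi).
Local Notation VC := (cplx V).
Local Notation F := (free_alg C (W + VC)%type).
Local Notation T w := (free_gen C (inl w : (W + VC)%type)).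
Local Notation O x := (free_gen C (inr x : (W + VC)%type)).

(* The bilinear extension of dot evaluated at a real and a complex vector *)
Definition dotC (a : V) (x : VC) : C := (dot a x.1 +i* dot a x.2)%C.

Inductive hecke_rel : F -> Prop :=
| hecke_linear c x y : hecke_rel (O (c *: x + y) - (c *: O x + O y))
(* t_1 is the unit, so that C[W] is a unital subalgebra. *)
| hecke_T1 : hecke_rel (T (weyl1 dot Phi) - 1)
| hecke_TM u w : hecke_rel (T u * T w - T (weylM u w))
| hecke_OC x y : hecke_rel (O x * O y - O y * O x)
| hecke_cross a (s : W) x : a \in Pi -> val s = refl dot a ->
    hecke_rel (O x * T s - T s * O (cplx_map (refl dot a) x)
               - ((k a)%:C%C * (2 * dotC a x / (dot a a)%:C%C))%:A).

Definition hecke : Type := presented hecke_rel.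
HB.instance Definition _ := GRing.PzRing.on hecke.
HB.instance Definition _ := GRing.Lmodule.on hecke.

Definition heckeT (w : W) : hecke := presented_class hecke_rel (T w).
Definition heckeO (x : VC) : hecke := presented_class hecke_rel (O x).

Record hecke_star (w0 : W) (star : hecke -> hecke) : Prop := HeckeStar {
  starD : forall h h', star (h + h') = star h + star h';
  starZ : forall c h, star (c *: h) = Num.conj_op c *: star h;
  starM : forall h h', star (h * h') = star h' * star h;
  starK : involutive star;
  starT : forall w, star (heckeT w) = heckeT (weylV w);
  starO : forall v : V, star (heckeO (to_cplx v)) =
    - (heckeT w0 * heckeO (to_cplx (val w0 v)) * heckeT w0)
}.

Variable star : hecke -> hecke.

Definition omega_tilde (v : V) : hecke :=
  (2^-1 : C) *: (heckeO (to_cplx v) - star (heckeO (to_cplx v))).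

Variable X : lmodType C.

Definition hecke_module (pi : hecke -> {linear X -> X}) : Prop :=
  representation (idfun : {rmorphism C -> C}) pi.

Definition star_hermitian (pi : hecke -> {linear X -> X}) : Prop :=
  exists B : {hermitian_sym X for Num.conj_op},
    (forall x, (forall y, B x y = 0) -> x = 0) /\
    forall h x y, B (pi h x) y = B x (pi (star h) y).

Definition one_W_type (pi : hecke -> {linear X -> X}) : Prop :=
  [/\ hecke_module pi, simple_action pi, star_hermitian pi
    & simple_action (fun w : W => pi (heckeT w))].

End Hecke.

Section Clifford.
Variables (R : realType) (V : vectType R) (dot : {dot V for idfun}).

Local Notation G v := (free_gen R (v : V)).

Inductive clifford_rel : free_alg R V -> Prop :=
| clifford_linear c u v : clifford_rel (G (c *: u + v) - (c *: G u + G v))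
| clifford_sq u v : clifford_rel (G u * G v + G v * G u - (- 2 * dot u v)%:A).

Definition clifford : Type := presented clifford_rel.
HB.instance Definition _ := GRing.PzRing.on clifford.
HB.instance Definition _ := GRing.Lmodule.on clifford.

Definition cliffordV (v : V) : clifford := presented_class clifford_rel (G v).

Definition spin_module (S : lmodType R[i]) (gam : clifford -> {linear S -> S})
    : Prop :=
  representation (real_complex R : {rmorphism R -> R[i]}) gam /\
  simple_action gam.

End Clifford.

Section Dirac.
Variables (R : realType) (V : vectType R) (dot : {dot V for idfun}).
Variables (Phi Pi : seq V) (k : V -> R).
Variables (star : hecke dot Phi Pi k -> hecke dot Phi Pi k).
Variables (X S : lmodType R[i]).
Variables (pi : hecke dot Phi Pi k -> {linear X -> X}).
Variables (gam : clifford dot -> {linear S -> S}).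
Variable e : seq V.

(* The action of \sum_v omega_tilde(v) (x) v, v ranging over an orthonormal
   basis e. *)
Definition dirac : {linear tensor X S -> tensor X S} :=
  tensor_map_sum e (fun v => pi (omega_tilde star v))
    (fun v => gam (cliffordV dot v)).

Definition dirac_cohomology : Type := cohomology dirac.
HB.instance Definition _ := GRing.Lmodule.on dirac_cohomology.

End Dirac.

(* Main.v *)
Require Import Defs.
From HB Require Import structures.
From mathcomp Require Import freeg.
From mathcomp Require Import all_boot all_order all_algebra.
From mathcomp Require Import sesquilinear complex boolp reals.
From mathcomp Require Import ring zify.

(** Write [omega = T + A] on [X], where [A] is the action of [omega_tilde]; it
    suffices to show [A = 0], since then the Dirac operator vanishes.  Applying
    [*] to the cross relation shows that [omega] and [omega^*] satisfy the same
    cross relation with the simple reflections, so that [A] is [W]-equivariant.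
    As [X] is irreducible over [W], it is enough that [tr (t_w A_v) = 0] for all
    [w] and [v]; by equivariance one may assume that [v] is fixed by [w] and
    dominant.  Then [w] is a product of simple reflections fixing [v], so [t_w]
    commutes with [v], and [tr (t_w v^* ) = conj (tr (t_w^-1 v)) = tr (t_w v)]
    as soon as [v] has real eigenvalues.

    Eigenvalues are real: otherwise let [u] be the imaginary part of a weight,
    of maximal norm and dominant.  The intertwiners [a t_s - k_a] show that the
    sums of generalized weight spaces with imaginary part in the orbit of [u]
    have equal dimension, so [X] is induced from the stabilizer of [u].  By
    Mackey's criterion applied to a simple reflection moving [u], a module
    induced from the stabilizer of a nonzero vector is reducible. *)

Set Implicit Arguments.
Unset Strict Implicit.
Unset Printing Implicit Defensive.

Import Order.TTheory GRing.Theory Num.Theory.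
Local Open Scope ring_scope.

(** * Reflections and the Weyl group *)

Section Reflections.
Variables (R : realType) (V : vectType R) (dot : {dot V for idfun}).
Implicit Types (a b u v : V).

Lemma dot_sym u v : dot u v = dot v u.
Proof. by rewrite hermC expr0 mul1r. Qed.

Lemma dot_gt0 u : (0 < dot u u) = (u != 0).
Proof.
have [->|nz] := eqVneq u 0; first by rewrite linear0r ltxx.
exact: neq0_dnorm_gt0.
Qed.

Lemma dot_ge0 u : 0 <= dot u u.
Proof.
have [->|nz] := eqVneq u 0; first by rewrite linear0r.
by rewrite ltW // dot_gt0.
Qed.

Lemma dot_eq0 u : (dot u u == 0) = (u == 0).
Proof.
have [->|nz] := eqVneq u 0; first by rewrite linear0r eqxx.
by rewrite gt_eqF // dot_gt0.
Qed.

Lemma dotZl c u v : dot (c *: u) v = c * dot u v.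
Proof. by rewrite linearZl_LR. Qed.

Lemma dotZr c u v : dot u (c *: v) = c * dot u v.
Proof. by rewrite dot_sym dotZl dot_sym. Qed.

Lemma dotDl u v w : dot (u + v) w = dot u w + dot v w.
Proof. exact: linearDl. Qed.

Lemma dotNl u v : dot (- u) v = - dot u v.
Proof. exact: linearNl. Qed.

Lemma dotNr u v : dot u (- v) = - dot u v.
Proof. exact: linearNr. Qed.

Lemma dotBl u v w : dot (u - v) w = dot u w - dot v w.
Proof. exact: linearBl. Qed.

Lemma dotBr u v w : dot u (v - w) = dot u v - dot u w.
Proof. exact: linearBr. Qed.

Lemma dot0l v : dot 0 v = 0.
Proof. exact: linear0l. Qed.

Lemma dot_suml (r : seq V) (c : V -> R) v :
  dot (\sum_(x <- r) c x *: x) v = \sum_(x <- r) c x * dot x v.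
Proof.
elim: r => [|x r IH]; first by rewrite !big_nil dot0l.
by rewrite !big_cons dotDl dotZl IH.
Qed.

Lemma refl_self a : refl dot a a = - a.
Proof.
rewrite reflE; have [->|nz] := eqVneq a 0; first by rewrite scaler0 subr0 oppr0.
rewrite mulfK ?dot_eq0 // scaler_nat mulr2n opprD addrA subrr.
by rewrite add0r.
Qed.

Lemma refl_orth a v : dot a v = 0 -> refl dot a v = v.
Proof. by move=> h; rewrite reflE h mulr0 mul0r scale0r subr0. Qed.

Lemma reflK a : involutive (refl dot a).
Proof.
move=> v; rewrite (reflE dot a v) linearB linearZ /= refl_self reflE.
by rewrite scalerN opprK subrK.
Qed.

Lemma refl_dot a u v : dot (refl dot a u) v = dot u (refl dot a v).
Proof.
by rewrite !reflE dotBl dotBr dotZl dotZr (dot_sym u a); ring.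
Qed.

Lemma refl_isom a u v : dot (refl dot a u) (refl dot a v) = dot u v.
Proof. by rewrite refl_dot reflK. Qed.

Lemma reflZ c a : c != 0 -> refl dot (c *: a) = refl dot a.
Proof.
move=> nz; apply/lfunP => v; rewrite !reflE; congr (_ - _).
rewrite !dotZl dotZr scalerA; congr (_ *: _).
have [->|a0] := eqVneq a 0; first by rewrite !dot0l !(mulr0, invr0, mul0r).
by field; rewrite dot_eq0 a0.
Qed.

End Reflections.

(** * Words in simple reflections, and stabilizers of dominant vectors *)

Section WeylGroup.
Variables (R : realType) (V : vectType R) (dot : {dot V for idfun}).
Variables (Phi Phip Pi : seq V).
Hypothesis rootPhi : root_system dot Phi.
Implicit Types (a b u v : V) (w : 'End(V)).

Local Notation sw := (simple_word dot).

Lemma refl_comp a : (refl dot a \o refl dot a = \1)%VF.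
Proof. by apply/lfunP => v; rewrite comp_lfunE reflK id_lfunE. Qed.

Lemma simple_word_cat s t : sw (s ++ t) = (sw s \o sw t)%VF.
Proof. by elim: s => [|a s IH] /=; rewrite ?comp_lfun1l // IH comp_lfunA. Qed.

Lemma simple_word_revK s : (sw (rev s) \o sw s = \1)%VF.
Proof.
elim: s => [|a s IH]; first by rewrite comp_lfun1l.
rewrite rev_cons -cats1 simple_word_cat /= comp_lfun1r -comp_lfunA.
by rewrite (comp_lfunA (refl dot a)) refl_comp comp_lfun1l.
Qed.

Lemma simple_word_dot s u v : dot (sw s u) (sw s v) = dot u v.
Proof.
elim: s u v => [|a s IH] u v /=; first by rewrite !id_lfunE.
by rewrite !comp_lfunE /= refl_isom IH.
Qed.

Lemma isom_lker0 w : (forall u v, dot (w u) (w v) = dot u v) -> lker w == 0%VS.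
Proof.
move=> h; apply/lker0P => x y exy; apply/eqP; rewrite -subr_eq0.
by rewrite -(dot_eq0 dot) -h linearB /= exy subrr linear0r.
Qed.

(** In the inverse case, [w'] maps the finite set [Phi] injectively into itself, hence onto itself,
    so the inverse preserves [Phi] as well. *)
Lemma in_weyl_isom w : in_weyl dot Phi w ->
  (forall u v, dot (w u) (w v) = dot u v) /\
  (forall a, a \in Phi -> w a \in Phi).
Proof.
case: rootPhi => _ _ stab _.
elim=> [|a aP|u w' _ [iu su] _ [iw sw']|w' _ [iw sw']].
- by split=> *; rewrite !id_lfunE.
- by split=> [u v|b bP]; [rewrite refl_isom | apply: stab].
- by split=> [x y|b bP]; rewrite !comp_lfunE ?iu ?iw //; apply: su; apply: sw'.
- have k0 := isom_lker0 iw; split=> [x y|b bP].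
    by rewrite -iw !lker0_lfunVK.
  have um : uniq (map w' (undup Phi)).
    by rewrite map_inj_uniq ?undup_uniq //; apply/lker0P.
  have sm : {subset map w' (undup Phi) <= undup Phi}.
    by move=> x /mapP[y]; rewrite !mem_undup => yP ->; apply: sw'.
  have [|_ memE] := uniq_min_size um sm; first by rewrite size_map.
  have := memE b; rewrite mem_undup bP => /mapP[c].
  by rewrite mem_undup => cP ->; rewrite lker0_lfunK.
Qed.

Lemma in_weyl_dot w u v : in_weyl dot Phi w -> dot (w u) (w v) = dot u v.
Proof. by move=> /in_weyl_isom[h _]; apply: h. Qed.

Lemma in_weyl_root w a : in_weyl dot Phi w -> a \in Phi -> w a \in Phi.
Proof. by move=> /in_weyl_isom[_]; apply. Qed.

Lemma refl_conj w a : (forall u v, dot (w u) (w v) = dot u v) ->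
  (refl dot (w a) \o w = w \o refl dot a)%VF.
Proof.
move=> h; apply/lfunP => v; rewrite !comp_lfunE !reflE !h.
by rewrite [in RHS]linearB /= [in RHS]linearZ /=.
Qed.

Lemma root_refl a b : a \in Phi -> b \in Phi -> refl dot a b \in Phi.
Proof. by case: rootPhi => _ _ + _; apply. Qed.

Lemma root_opp a : a \in Phi -> - a \in Phi.
Proof. by move=> aP; rewrite -(refl_self dot) root_refl. Qed.

Hypothesis posPhip : positive_system dot Phi Phip.
Hypothesis simplePi : simple_roots Phip Pi.

Lemma root_neq0 a : a \in Phi -> a != 0.
Proof. by case: rootPhi => n0 _ _ _; apply: contraTneq => ->. Qed.

Lemma pos_root a : a \in Phip -> a \in Phi.
Proof. by case: posPhip => g [_ ->] /andP[]. Qed.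

Lemma simple_pos a : a \in Pi -> a \in Phip.
Proof. by case: simplePi => _ + _; apply. Qed.

Lemma simple_root a : a \in Pi -> a \in Phi.
Proof. by move=> /simple_pos/pos_root. Qed.

Lemma root_pos_or_neg a : a \in Phi -> (a \in Phip) || (- a \in Phip).
Proof.
case: posPhip => g [reg pE] aP; rewrite !pE aP root_opp //=.
by rewrite dotNr oppr_gt0; case: ltgtP (reg a aP).
Qed.

Lemma pos_not_neg a : a \in Phip -> - a \in Phip -> False.
Proof.
case: posPhip => g [_ pE]; rewrite !pE => /andP[_ h] /andP[_].
by rewrite dotNr oppr_gt0 ltNge ltW.
Qed.

Lemma free_coef (r : seq V) (c : V -> R) :
  free r -> \sum_(x <- r) c x *: x = 0 -> forall x, x \in r -> c x = 0.
Proof.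
move=> fr h x /(nthP 0)[i ir <-].
have /freeP/(_ (fun i => c r`_i)) := fr : free (in_tuple r).
move/(_ _ (Ordinal ir)); apply; rewrite -[RHS]h (big_nth 0) big_mkord.
by apply: eq_bigr.
Qed.

(** [refl dot a] changes only the coefficient at [a]. If [b] has a positive coefficient at another
    simple root, the reflected root cannot be negative: that coefficient and the one in the opposite
    root are nonnegative with sum zero. The first alternative allows multiples of [a], as
    [root_system] excludes only doubles. *)
Lemma simple_refl_pos a b : a \in Pi -> b \in Phip ->
  (exists c, b = c *: a) \/ refl dot a b \in Phip.
Proof.
move=> aP bP; case: simplePi => /andP[_ fPi] _ dec.
have [c c0 bE] := dec b bP.
have [/allP z|/allPn[x xP]] := boolP (all (fun x => (x == a) || (c x == 0)) Pi).
  left; exists (c a); rewrite bE (bigD1_seq a) ?free_uniq //=.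
  rewrite big_seq_cond big1 ?addr0 // => x /andP[xP xa].
  by have := z x xP; rewrite (negPf xa) => /eqP ->; rewrite scale0r.
rewrite negb_or => /andP[xa cx]; right.
have /root_pos_or_neg/orP[//|neg] : refl dot a b \in Phi.
  by apply: root_refl; [apply: simple_root | apply: pos_root].
have [d d0 nE] := dec _ neg.
move: nE; rewrite reflE; set t := _ / _ => nE.
have : \sum_(y <- Pi) (c y + d y - t * (y == a)%:R) *: y = 0.
  under eq_bigr do rewrite scalerBl scalerDl.
  rewrite sumrB big_split /= -bE -nE (bigD1_seq a) ?free_uniq //= eqxx mulr1.
  rewrite [X in _ - (_ + X)]big1 => [|y /negPf ->]; last by rewrite mulr0 scale0r.
  by rewrite addr0 opprB addrCA subrr addr0 subrr.
move/(free_coef fPi)/(_ x xP); rewrite (negPf xa) mulr0 subr0 => /eqP.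
by rewrite paddr_eq0 // (negPf cx).
Qed.

Lemma simple_word_root s a : {subset s <= Pi} -> a \in Phi -> sw s a \in Phi.
Proof.
move=> + aP; elim: s => [|c s IH] sP /=; first by rewrite id_lfunE.
rewrite comp_lfunE; apply: root_refl.
  by rewrite simple_root // sP ?mem_head.
by apply: IH => x xs; apply: sP; rewrite inE xs orbT.
Qed.

(** At the letter [b] where the image of [a] turns negative, that image is a multiple of [b].
    Conjugation then turns the reflection in [a] into a second reflection in [b], and the two
    cancel. *)
Lemma word_deletion s a : {subset s <= Pi} -> a \in Pi ->
  - sw s a \in Phip ->
  exists t, [/\ {subset t <= Pi}, (size t < size s)%N &
    sw t = (sw s \o refl dot a)%VF].
Proof.
move=> sP aP; elim: s sP => [|b s IH] sP /=.
  by rewrite id_lfunE => /(pos_not_neg (simple_pos aP)).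
have bP : b \in Pi by apply: sP; rewrite mem_head.
have sP' : {subset s <= Pi} by move=> x xs; apply: sP; rewrite inE xs orbT.
have iso := simple_word_dot s.
have rootP : sw s a \in Phi by rewrite simple_word_root ?simple_root.
rewrite comp_lfunE => neg.
case/orP: (root_pos_or_neg rootP) => [pos|ng].
  have [[c cE]|/pos_not_neg/(_ neg)//] := simple_refl_pos bP pos.
  have c0 : c != 0.
    by apply: contraTneq (root_neq0 rootP) => c0; rewrite cE c0 scale0r eqxx.
  exists s; split=> //.
  rewrite -comp_lfunA -refl_conj // cE reflZ // comp_lfunA refl_comp.
  by rewrite comp_lfun1l.
have [t [tP st tE]] := IH sP' ng.
exists (b :: t); split=> //=; last by rewrite tE comp_lfunA.
by move=> x; rewrite inE => /orP[/eqP ->|/tP].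
Qed.

(** Induction on the length, looking at the last letter [a]. If the rest of the word sends [a] to a
    negative root, deletion shortens the word. Otherwise the whole word [w] does so, and [dot a v =
    dot (w a) (w v) = dot (w a) v <= 0]; dominance makes [a] orthogonal to [v], and the letter can
    be split off. *)
Lemma dominant_stab v s : (forall a, a \in Pi -> 0 <= dot a v) ->
  {subset s <= Pi} -> sw s v = v ->
  exists t, (forall a, a \in t -> a \in Pi /\ dot a v = 0) /\ sw t = sw s.
Proof.
move=> dom; have [n] := ubnP (size s); elim: n s => // n IH s.
case/lastP: s => [_ _ _|s a]; first by exists [::].
rewrite size_rcons ltnS => sn saP wv.
have aP : a \in Pi by apply: saP; rewrite mem_rcons mem_head.
have sP : {subset s <= Pi} by move=> x xs; apply: saP; rewrite mem_rcons inE xs orbT.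
have swE : sw (rcons s a) = (sw s \o refl dot a)%VF.
  by rewrite -cats1 simple_word_cat /= comp_lfun1r.
have rootP : sw s a \in Phi by rewrite simple_word_root ?simple_root.
case/orP: (root_pos_or_neg rootP) => [pos|ng]; last first.
  have [t [tP st tE]] := word_deletion sP aP ng.
  rewrite swE -tE; apply: IH => //; first exact: leq_trans st (ltnW sn).
  by rewrite tE -swE.
have av : dot a v = 0.
  apply/eqP; rewrite eq_le dom // andbT.
  rewrite -(simple_word_dot (rcons s a)) wv swE comp_lfunE refl_self linearN /=.
  rewrite dotNl oppr_le0; case: simplePi => _ _ dec.
  have [c c0 ->] := dec _ pos; rewrite dot_suml big_seq sumr_ge0 // => x xP.
  by rewrite mulr_ge0 // dom.
have rv := refl_orth av.
have [|t [tP tE]] := IH s sn sP; first by rewrite -{2}wv swE comp_lfunE rv.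
exists (rcons t a); split=> [x|].
  by rewrite mem_rcons inE => /orP[/eqP ->|/tP].
by rewrite swE -tE -cats1 simple_word_cat /= comp_lfun1r.
Qed.

End WeylGroup.

(** [weyl] carries only the structure of a choice type; averages over the group run over a list
    obtained from here. *)
Lemma finite_enum (T : choiceType) (F : finType) (f : T -> F) :
  injective f -> exists s : seq T, uniq s /\ forall x, x \in s.
Proof.
move=> finj.
pose g y := if pselect (exists x, f x = y) is left h then Some (projT1 (cid h)) else None.
exists (undup (pmap g (enum F))); split=> [|x]; first exact: undup_uniq.
rewrite mem_undup mem_pmap; apply/mapP; exists (f x); first by rewrite mem_enum.
rewrite /g; case: pselect => [h|[]]; last by exists x.
by case: cid => y /= /finj ->.
Qed.

(** * The Weyl group as a finite group *)

Section WeylType.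
Variables (R : realType) (V : vectType R) (dot : {dot V for idfun}).
Variables (Phi Phip Pi : seq V).
Hypothesis rootPhi : root_system dot Phi.
Implicit Types (a b v : V).

Local Notation W := (weyl dot Phi).
Local Notation "1" := (weyl1 dot Phi) : weyl_scope.
Local Notation "u * w" := (weylM u w) : weyl_scope.
Local Notation "w ^-1" := (weylV w) : weyl_scope.
Local Open Scope weyl_scope.

Implicit Types (u w : W).

Lemma weyl_valP w : in_weyl dot Phi (val w).
Proof. by apply/asboolP; apply: (valP w). Qed.

Lemma weylME u w v : val (u * w) v = val u (val w v).
Proof. by rewrite comp_lfunE. Qed.

Lemma weyl1E v : val (1 : W) v = v.
Proof. by rewrite id_lfunE. Qed.

Lemma weyl_ext u w : (forall v, val u v = val w v) -> u = w.
Proof. by move=> h; apply/val_inj/lfunP. Qed.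

Lemma weyl_dot w a b : dot (val w a) (val w b) = dot a b.
Proof. exact: (in_weyl_dot rootPhi _ _ (weyl_valP w)). Qed.

Lemma weyl_lker0 w : lker (val w) == 0%VS.
Proof. exact: isom_lker0 (weyl_dot w). Qed.

Lemma weylVK w v : val (w^-1) (val w v) = v.
Proof. by rewrite lker0_lfunK ?weyl_lker0. Qed.

Lemma weylKV w v : val w (val (w^-1) v) = v.
Proof. by rewrite lker0_lfunVK ?weyl_lker0. Qed.

Lemma weyl_mulA u w z : u * (w * z) = (u * w) * z.
Proof. by apply: weyl_ext => v; rewrite !weylME. Qed.

Lemma weyl_mul1 w : 1 * w = w.
Proof. by apply: weyl_ext => v; rewrite weylME weyl1E. Qed.

Lemma weyl_mulr1 w : w * 1 = w.
Proof. by apply: weyl_ext => v; rewrite weylME weyl1E. Qed.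

Lemma weyl_mulV w : w * w^-1 = 1.
Proof. by apply: weyl_ext => v; rewrite weylME weyl1E weylKV. Qed.

Lemma weyl_mulVl w : w^-1 * w = 1.
Proof. by apply: weyl_ext => v; rewrite weylME weyl1E weylVK. Qed.

Lemma weyl_inv1 : 1^-1 = 1 :> W.
Proof. by rewrite -[LHS]weyl_mul1 weyl_mulV. Qed.

Lemma weyl_invK w : (w^-1)^-1 = w.
Proof. by apply: weyl_ext => v; rewrite -[in LHS](weylVK w v) (weylVK (w^-1)). Qed.

Lemma weyl_invM u w : (u * w)^-1 = w^-1 * u^-1.
Proof.
apply: weyl_ext => v; rewrite -[in LHS](weylKV u v).
rewrite -[in LHS](weylKV w (val (u^-1) v)).
by rewrite -(weylME u w) weylVK -weylME.
Qed.

Lemma refl_weylP a : a \in Phi -> exists s : W, val s = refl dot a.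
Proof.
move=> aP; have h : `[< in_weyl dot Phi (refl dot a) >] by apply/asboolP/in_weyl_refl.
by exists (Sub (refl dot a) h); rewrite SubK.
Qed.

Lemma weyl_reflV (s : W) a : val s = refl dot a -> s^-1 = s.
Proof.
by move=> sE; apply: weyl_ext => v; rewrite -[in LHS](reflK dot a v) -sE weylVK.
Qed.

(** The roots span [V], so an element is determined by the positions in [Phi] of the images of the
    roots. *)
Lemma weyl_finite : exists ws : seq W, uniq ws /\ forall w, w \in ws.
Proof.
have idx w (i : 'I_(size Phi)) : (index (val w (Phi`_i)%R) Phi < size Phi)%N.
  by rewrite index_mem (in_weyl_root rootPhi (weyl_valP w)) ?mem_nth.
pose f w := [ffun i => Ordinal (idx w i)].
apply: (@finite_enum _ _ f) => u w /ffunP fE.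
have onPhi a : a \in Phi -> val u a = val w a.
  move=> /(nthP 0)[i ir <-]; have := fE (Ordinal ir); rewrite !ffunE.
  case=> /(congr1 (nth 0 Phi)).
  by rewrite !nth_index ?(in_weyl_root rootPhi (weyl_valP _)) ?mem_nth.
apply: weyl_ext => v; case: (rootPhi) => _ spanE _ _.
have : v \in <<Phi>>%VS by rewrite spanE memvf.
rewrite -[Phi]/(tval (in_tuple Phi)) => /coord_span ->; rewrite !linear_sum; apply: eq_bigr => i _.
by rewrite !linearZ /= onPhi // mem_nth.
Qed.

Lemma perm_weylMl ws w : uniq ws -> (forall w, w \in ws) ->
  perm_eq [seq w * u | u <- ws] ws.
Proof.
move=> wsU wsP; apply: uniq_perm => //.
  rewrite map_inj_uniq // => u z /(congr1 (weylM (w^-1))).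
  by rewrite !weyl_mulA weyl_mulVl !weyl_mul1.
move=> z; rewrite wsP; apply/mapP; exists (w^-1 * z) => //.
by rewrite weyl_mulA weyl_mulV weyl_mul1.
Qed.

Lemma weyl_expE w k v : val (iter k (weylM w) 1) v = iter k (val w) v.
Proof. by elim: k => [|k IH] /=; rewrite ?weyl1E // weylME IH. Qed.

Lemma weyl_order w : exists2 m, (0 < m)%N & iter m (weylM w) 1 = 1.
Proof.
have [ws [wsU wsP]] := weyl_finite.
pose p := fun k => iter k (weylM w) 1.
have inj_step j k : p (j + k)%N = p j -> p k = 1.
  elim: j => [//|j IH]; rewrite addSn /= => /(congr1 (weylM (w^-1))).
  by rewrite !weyl_mulA weyl_mulVl !weyl_mul1.
(* Pigeonhole: these [(size ws).+1] powers of [w] cannot be distinct. *)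
have : ~~ uniq [seq p k | k <- iota 0 (size ws).+1].
  apply/negP => /uniq_leq_size/(_ (fun x _ => wsP x)).
  by rewrite size_map size_iota ltnn.
move=> /(uniqPn 1)[j [k [jk kS]]].
rewrite size_map size_iota in kS.
rewrite !(nth_map 0%N) ?size_iota ?(ltn_trans jk) // !nth_iota ?(ltn_trans jk) //.
rewrite !add0n => E; exists (k - j)%N; first by rewrite subn_gt0.
by apply: (inj_step j); rewrite subnKC ?(ltnW jk) // -E.
Qed.

Hypothesis posPhip : positive_system dot Phi Phip.
Hypothesis simplePi : simple_roots Phip Pi.

(** Minimal counterexample [d] for the height [dot g]. As [dot d d > 0] and [d] is a nonnegative
    combination of simple roots, some simple [a] has [dot a d > 0]. Unless [d] is a multiple of [a],
    the root [refl dot a d] is positive and lower, and conjugating its word by [refl dot a] gives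
    one for [d]. *)
Lemma refl_simple_word b : b \in Phi ->
  exists2 s, {subset s <= Pi} & simple_word dot s = refl dot b.
Proof.
pose good b := exists2 s, {subset s <= Pi} & simple_word dot s = refl dot b.
have [g [_ pE]] := posPhip.
suff pos c : c \in Phip -> good c.
  move=> /(root_pos_or_neg rootPhi posPhip)/orP[/pos//|/pos].
  by rewrite /good -scaleN1r reflZ // oppr_eq0 oner_eq0.
move=> /(nthP 0)[i ir <-]; apply: contrapT => bad.
pose P (i : 'I_(size Phip)) := `[< ~ good (Phip`_i) >].
have Pi0 : P (Ordinal ir) by apply/asboolP.
case: (arg_minP (fun i : 'I_(size Phip) => dot g (Phip`_i)) Pi0) => j /asboolP Pj jmin.
apply: Pj; set d := Phip`_j in jmin *.
have dP : d \in Phip by rewrite mem_nth.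
have [_ _ /(_ d dP)[m m0 dE]] := simplePi.
have [a aP ad] : exists2 a, a \in Pi & 0 < dot a d.
  apply: contrapT => no.
  have : dot d d <= 0.
    rewrite {1}dE dot_suml big_seq sumr_le0 // => x xP.
    rewrite mulr_ge0_le0 // leNgt; apply/negP => h; apply: no; by exists x.
  by rewrite leNgt dot_gt0 (root_neq0 rootPhi (pos_root posPhip dP)).
have a0 := root_neq0 rootPhi (simple_root posPhip simplePi aP).
case: (simple_refl_pos rootPhi posPhip simplePi aP dP) => [[t tE]|rP].
  exists [:: a]; first by move=> x; rewrite inE => /eqP ->.
  rewrite /= comp_lfun1r tE reflZ //; apply: contraTneq ad => t0.
  by rewrite tE t0 scale0r linear0r ltxx.
have [s sP sE] : good (refl dot a d).
  move: (rP) => /(nthP 0)[l lr lE]; rewrite -lE; apply: contrapT => badl.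
  have /jmin /= : P (Ordinal lr) by apply/asboolP.
  rewrite lE leNgt reflE dotBr dotZr gtrBl => /negP; apply.
  rewrite mulr_gt0 ?divr_gt0 ?mulr_gt0 ?dot_gt0 //.
  by move: (simple_pos simplePi aP); rewrite pE => /andP[].
exists (a :: rcons s a).
  by move=> x; rewrite inE mem_rcons inE => /or3P[/eqP->|/eqP->|/sP].
rewrite /= -cats1 simple_word_cat /= comp_lfun1r sE comp_lfunA.
rewrite -(refl_conj _ (refl_isom dot a)) reflK -comp_lfunA.
by rewrite refl_comp comp_lfun1r.
Qed.

Lemma weyl_simple_word w : exists2 s, {subset s <= Pi} & simple_word dot s = val w.
Proof.
elim: (weyl_valP w) => [|a aP|x y _ [s sP sE] _ [t tP tE]|x xP [s sP sE]].
- by exists [::].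
- exact: refl_simple_word.
- exists (s ++ t); last by rewrite simple_word_cat sE tE.
  by move=> z; rewrite mem_cat => /orP[/sP|/tP].
- exists (rev s); first by move=> z; rewrite mem_rev => /sP.
  have := simple_word_revK dot s; rewrite sE => h.
  have k0 : lker x == 0%VS.
    by apply: isom_lker0 => a b; apply: (in_weyl_dot rootPhi).
  apply/lfunP => v; rewrite -{1}(lker0_lfunVK k0 v).
  by have /lfunP/(_ (x^-1%VF v)) := h; rewrite comp_lfunE id_lfunE.
Qed.

(** The step only concerns letters of [t], so that one induction serves both the whole group and the
    stabilizer of a dominant vector. *)
Lemma weyl_word_ind (t : seq V) (Q : W -> Prop) w : {subset t <= Phi} ->
  Q 1 ->
  (forall s a u, a \in t -> val s = refl dot a -> Q u -> Q (s * u)) ->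
  simple_word dot t = val w -> Q w.
Proof.
elim: t w => [|a t IH] w tP Q1 Qs /=.
  by move=> wE; have -> : w = 1 by apply: val_inj; apply: esym wE.
move=> wE; have [s sE] : exists s : W, val s = refl dot a.
  by apply: refl_weylP; apply: tP; rewrite mem_head.
have -> : w = s * (s^-1 * w) by rewrite weyl_mulA weyl_mulV weyl_mul1.
apply: (Qs s a); rewrite ?mem_head //; apply: IH => //.
- by move=> x xt; apply: tP; rewrite inE xt orbT.
- by move=> s' b u bt; apply: Qs; rewrite inE bt orbT.
- apply/lfunP => v; rewrite (weyl_reflV sE) weylME sE.
  by have -> : val w = _ := esym wE; rewrite comp_lfunE reflK.
Qed.

Lemma weyl_ind (Q : W -> Prop) : Q 1 ->
  (forall s a u, a \in Pi -> val s = refl dot a -> Q u -> Q (s * u)) ->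
  forall w, Q w.
Proof.
move=> Q1 Qs w; have [t tP tE] := weyl_simple_word w.
apply: weyl_word_ind tE => // [a /tP/(simple_root posPhip simplePi)//|s a u /tP].
exact: Qs.
Qed.

Lemma weyl_stab_ind v (Q : W -> Prop) : (forall a, a \in Pi -> 0 <= dot a v) ->
  Q 1 ->
  (forall s a u, a \in Pi -> dot a v = 0 -> val s = refl dot a -> Q u -> Q (s * u)) ->
  forall w, val w v = v -> Q w.
Proof.
move=> dom Q1 Qs w wv; have [s sP sE] := weyl_simple_word w.
have [|t [tP tE]] := dominant_stab rootPhi posPhip simplePi dom sP.
  by rewrite sE.
rewrite -tE in sE; apply: weyl_word_ind sE => //.
  by move=> a /tP[/(simple_root posPhip simplePi)].
by move=> s' a u /tP[aP av]; apply: Qs.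
Qed.

(** Take [w] maximizing [dot g (val w v)]. A simple reflection cannot increase this value, and
    [dot g a > 0] for simple [a]. *)
Lemma dominant_conj v :
  exists w : W, forall a, a \in Pi -> 0 <= dot a (val w v).
Proof.
have [ws [_ wsP]] := weyl_finite; have [g [_ pE]] := posPhip.
have ws0 : (index (weyl1 dot Phi) ws < size ws)%N by rewrite index_mem.
case: (arg_maxP (fun i : 'I_(size ws) => dot g (val (nth 1 ws i) v))
  (erefl : xpredT (Ordinal ws0))) => j _ jmax.
exists (nth 1 ws j) => a aP; set w := nth 1 ws j in jmax *.
have aPhi := simple_root posPhip simplePi aP.
have [s sE] := refl_weylP aPhi.
have swS : (index (weylM s w) ws < size ws)%N by rewrite index_mem.
have := jmax (Ordinal swS) isT; rewrite /= nth_index // weylME sE reflE.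
rewrite dotBr dotZr gerBl => h.
have ga : 0 < dot g a by move: (simple_pos simplePi aP); rewrite pE => /andP[].
move: h; rewrite pmulr_lge0 // pmulr_lge0 ?pmulr_rge0 //.
by rewrite invr_gt0 dot_gt0 (root_neq0 rootPhi).
Qed.

End WeylType.

(** * Matrices and averages over the Weyl group *)

Section MatrixLemmas.
Variables (C : numClosedFieldType) (n : nat).
Implicit Types (A B T U K : 'M[C]_n.+1) (p : {poly C}).

Lemma horner_mx_intertwine A B T p :
  A *m T = T *m B -> horner_mx A p *m T = T *m horner_mx B p.
Proof.
move=> AB; elim/poly_ind: p => [|p c IH]; first by rewrite !rmorph0 mul0mx mulmx0.
rewrite !rmorphD !rmorphM /= !horner_mx_X !horner_mx_C mulmxDl mulmxDr.
by rewrite -!mulmxE -mulmxA AB mulmxA IH -mulmxA scalar_mxC.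
Qed.

Lemma horner_mx_eigen (x : 'rV[C]_n.+1) A lam p :
  x *m A = lam *: x -> x *m horner_mx A p = p.[lam] *: x.
Proof.
move=> xA; elim/poly_ind: p => [|p c IH].
  by rewrite rmorph0 mulmx0 horner0 scale0r.
rewrite rmorphD rmorphM /= horner_mx_X horner_mx_C mulmxDr -mulmxE mulmxA IH.
by rewrite -scalemxAl xA scalerA mul_mx_scalar -scalerDl !hornerE.
Qed.

Lemma common_eigenvector_sub (As : seq 'M[C]_n.+1) U :
  U != 0 -> {in As &, forall A B, comm_mx A B} ->
  {in As, forall A, (U *m A <= U)%MS} ->
  exists x : 'rV_n.+1, [/\ x != 0, (x <= U)%MS &
    {in As, forall A, stablemx x A}].
Proof.
move=> U0 comm stab.
have [||v v0 /allP vP] := @common_eigenvector _ _ [seq restrictmx U A | A <- As].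
- by rewrite lt0n mxrank_eq0.
- move=> _ _ /mapP[A AP ->] /mapP[B BP ->]; rewrite /comm_mx.
  by rewrite -!conjmxM ?inE ?stablemx_row_base ?stab // comm.
exists (v *m row_base U); split.
- by rewrite mulmx_free_eq0 ?row_base_free.
- by rewrite mulmx_sub // eq_row_base.
- move=> A AP; rewrite -stablemx_restrict ?stab //; apply: vP.
  by apply/mapP; exists A.
Qed.

Lemma sumsmx_seq_sub (I : Type) (l : seq I) (P : pred I) (F : I -> 'M[C]_n.+1) m
    (B : 'M_(m, n.+1)) :
  (forall i, P i -> (F i <= B)%MS) -> (\sum_(i <- l | P i) F i <= B)%MS.
Proof.
move=> FB; elim: l => [|i l IH]; first by rewrite big_nil sub0mx.
by rewrite big_cons; case: ifP => // Pi; rewrite addsmx_sub FB.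
Qed.

Lemma mulmx_trig_diag (A B : 'M[C]_n.+1) i :
  is_trig_mx A -> is_trig_mx B -> (A *m B) i i = A i i * B i i.
Proof.
move=> /is_trig_mxP tA /is_trig_mxP tB; rewrite mxE (bigD1 i) //= big1 ?addr0 //.
move=> j ji; have [ij|ij|/val_inj ij] := ltngtP i j.
- by rewrite tA // mul0r.
- by rewrite tB // mulr0.
- by rewrite ij eqxx in ji.
Qed.

Lemma mulmx_is_trig (A B : 'M[C]_n.+1) :
  is_trig_mx A -> is_trig_mx B -> is_trig_mx (A *m B).
Proof.
move=> /is_trig_mxP tA /is_trig_mxP tB; apply/is_trig_mxP => i j ij.
rewrite mxE big1 // => l _; have [il|li] := ltnP i l; first by rewrite tA // mul0r.
by rewrite tB ?mulr0 // (leq_ltn_trans li).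
Qed.

(** Triangularize [A], [A'] and [B] simultaneously and compare diagonals. The entries of [A] are
    roots of unity, so their inverses, the entries of [A'], are their conjugates; the entries of [B]
    are eigenvalues, hence real. *)
Lemma trace_torsion_real A A' B m : (0 < m)%N -> A *m A' = 1%:M -> A ^+ m = 1 ->
  A *m B = B *m A -> (forall b, eigenvalue B b -> b \is Num.real) ->
  \tr (A *m B) = (\tr (A' *m B))^*.
Proof.
move=> m0 AA' Am AB realB; have A'A := mulmx1C AA'.
have A'B : A' *m B = B *m A'.
  by rewrite -[LHS]mulmx1 -AA' mulmxA -(mulmxA A') -AB mulmxA A'A mul1mx.
have [|P /unitarymx_unit Pu /allP Ptrig] := @cotrigonalization _ _ [:: A; A'; B].
  by move=> X Y; rewrite !inE => /or3P[]/eqP-> /or3P[]/eqP->; rewrite /comm_mx ?AA' ?A'A.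
pose c X := P *m X *m invmx P.
have ctrig X : X \in [:: A; A'; B] -> is_trig_mx (c X).
  by move=> /Ptrig; rewrite /simmx_to_for /c -conjumx.
have cM X Y : c (X *m Y) = c X *m c Y by rewrite /c !mulmxA mulmxKV.
have c1 : c 1%:M = 1%:M by rewrite /c mulmx1 mulmxV.
have ctr X : \tr (c X) = \tr X by rewrite /c mxtrace_mulC mulmxA mulVmx ?mul1mx.
have realc b : eigenvalue (c B) b -> b \is Num.real.
  move=> hb; apply: realB; apply: (@eigenvalue_conjmx _ _ _ P).
  - by rewrite stablemx_unit.
  - by rewrite row_free_unit.
  - by rewrite conjumx.
clearbody c.
have tA : is_trig_mx (c A) by rewrite ctrig // !inE eqxx.
have tA' : is_trig_mx (c A') by rewrite ctrig // !inE eqxx orbT.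
have tB : is_trig_mx (c B) by rewrite ctrig // !inE eqxx !orbT.
rewrite -ctr -[\tr (A' *m B)]ctr !cM /mxtrace rmorph_sum; apply: eq_bigr => i _.
rewrite !mulmx_trig_diag // rmorphM /=; congr (_ * _).
  have tX k : is_trig_mx (c (A ^+ k)) /\ (c (A ^+ k)) i i = (c A) i i ^+ k.
    elim: k => [|k [IH1 IH2]]; first by rewrite expr0 c1 scalar_mx_is_trig mxE eqxx.
    rewrite exprS -mulmxE cM mulmx_trig_diag // IH2 exprS; split=> //.
    by apply: mulmx_is_trig.
  have d1 : (c A) i i ^+ m = 1 by have [_ <-] := tX m; rewrite Am c1 mxE eqxx.
  have n1 : `|(c A) i i| = 1 by apply/eqP; rewrite -(pexpr_eq1 m0) // -normrX d1 normr1.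
  have dd : (c A) i i * (c A') i i = 1.
    by rewrite -mulmx_trig_diag // -cM AA' c1 mxE eqxx.
  have nz : (c A) i i != 0 by rewrite -normr_eq0 n1 oner_eq0.
  have -> : (c A') i i = ((c A) i i)^-1 by rewrite -[RHS]mulr1 -dd mulKf.
  by rewrite invC_norm n1 expr1n invr1 mul1r conjCK.
apply/esym/conj_Creal/realc; rewrite eigenvalue_root_char.
rewrite char_poly_trig // -(big_map _ predT (fun x => 'X - x%:P)) root_prod_XsubC.
by apply/mapP; exists i; rewrite ?mem_index_enum.
Qed.

(** * Schur's lemma and orthogonality of matrix coefficients *)

Section Average.
Variables (R : realType) (V : vectType R) (dot : {dot V for idfun}) (Phi : seq V).
Hypothesis rootPhi : root_system dot Phi.
Local Notation W := (weyl dot Phi).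
Variables (r : W -> 'M[C]_n.+1) (ws : seq W).
Hypothesis wsU : uniq ws.
Hypothesis wsP : forall w, w \in ws.
Hypothesis r1 : r (weyl1 dot Phi) = 1%:M.
Hypothesis rM : forall u w, r (weylM u w) = r u *m r w.
Hypothesis irr : forall U, U != 0 -> (forall w, (U *m r w <= U)%MS) -> row_full U.

Lemma repVl w : r (weylV w) *m r w = 1%:M.
Proof. by rewrite -rM weyl_mulVl. Qed.

(** An eigenspace of [T] is nonzero and stable under all [r w], hence is everything. *)
Lemma schur_scalar T : (forall w, r w *m T = T *m r w) -> exists c, T = c%:M.
Proof.
move=> comm; have [c cE] := eigenvalue_closed T (ltn0Sn n).
exists c; have : row_full (eigenspace T c).
  apply: irr => // w; apply: comm_mx_stable_eigenspace.
  by rewrite /comm_mx comm.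
by rewrite -sub1mx => /eigenspaceP; rewrite mul1mx scalemx1.
Qed.

(** The sum commutes with every [r w], so it is a scalar, which its trace determines. *)
Lemma schur_average K :
  \sum_(w <- ws) r w *m K *m r (weylV w) = ((size ws)%:R * \tr K / n.+1%:R)%:M.
Proof.
set S := \sum_(w <- ws) _.
have [w|c SE] := @schur_scalar S.
  rewrite mulmx_sumr mulmx_suml.
  rewrite -[in RHS](perm_big _ (perm_weylMl rootPhi w wsU wsP)) /= big_map.
  apply: eq_bigr => u _; rewrite !rM weyl_invM // rM -!mulmxA.
  by rewrite repVl mulmx1.
have trS : \tr S = (size ws)%:R * \tr K.
  rewrite raddf_sum /= (eq_bigr (fun=> \tr K)) => [|w _].
    by rewrite big_const_seq count_predT iter_addr_0 mulr_natl.
  by rewrite mxtrace_mulC mulmxA repVl mul1mx.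
rewrite SE; congr (_%:M); rewrite -trS SE mxtrace_scalar -[c *+ _]mulr_natr mulfK //.
by rewrite pnatr_eq0.
Qed.

Lemma size_weyl_neq0 : (size ws)%:R != 0 :> C.
Proof.
by rewrite pnatr_eq0 -lt0n (leq_ltn_trans _ (_ : index (weyl1 dot Phi) ws < _)%N) // index_mem.
Qed.

(** The traces recover every entry of [A] through the inversion formula [E]. *)
Lemma trace_separates A : (forall w, \tr (r w *m A) = 0) -> A = 0.
Proof.
move=> trA; apply/matrixP => i j; rewrite mxE.
have tr_delta (b : 'I_n.+1) : \tr (delta_mx b i : 'M[C]_n.+1) = (b == i)%:R.
  rewrite /mxtrace (bigD1 b) //= mxE eqxx big1 ?addr0 // => a /negPf ab.
  by rewrite mxE ab.
have E : \sum_(w <- ws) \tr (r w *m A) * (r (weylV w)) i j = 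
         (size ws)%:R / n.+1%:R * A i j.
  (* The product of [r w a b] and [r (weylV w) i j] is the entry [(a, j)] of
     [r w *m delta_mx b i *m r (weylV w)], whose sum over the group [schur_average] evaluates. *)
  transitivity (\sum_a \sum_b A b a *
     (\sum_(w <- ws) (r w *m delta_mx b i *m r (weylV w)) a j)).
    rewrite (eq_bigr (fun w => \sum_a \sum_b A b a * (r w a b * (r (weylV w)) i j))).
      rewrite exchange_big; apply: eq_bigr => a _ /=.
      rewrite exchange_big; apply: eq_bigr => b _ /=.
      rewrite -mulr_sumr; congr (_ * _); apply: eq_bigr => w _.
      rewrite !mxE (bigD1 i) //= !mxE (bigD1 b) //= !mxE !eqxx mulr1.
      rewrite big1 ?addr0 => [|k /negPf kb]; last by rewrite !mxE kb mulr0.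
      rewrite big1 ?addr0 // => k /negPf ki.
      by rewrite mxE big1 ?mul0r // => l _; rewrite !mxE ki andbF mulr0.
    move=> w _; rewrite mulr_suml; apply: eq_bigr => a _.
    rewrite mxE mulr_suml; apply: eq_bigr => b _.
    by rewrite mulrA [A b a * _]mulrC.
  under eq_bigr => a _ do under eq_bigr => b _ do
    rewrite -summxE schur_average mxE.
  rewrite (bigD1 j) //= [X in _ + X]big1 => [|a /negPf aj]; last first.
    by rewrite big1 // => b _; rewrite aj mulr0.
  rewrite addr0 (bigD1 i) //= [X in _ + X]big1 => [|b /negPf bi]; last first.
    by rewrite tr_delta bi mulr0 mul0r mul0rn mulr0.
  by rewrite addr0 tr_delta !eqxx mulr1 mulrC.
move: E; under eq_bigr do rewrite trA mul0r.
rewrite big1 // => /esym/eqP; rewrite !mulf_eq0 invr_eq0 (negPf size_weyl_neq0).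
by rewrite pnatr_eq0 /= => /eqP.
Qed.
End Average.
End MatrixLemmas.

(** * Weights *)

Lemma pair_ortho_rec_dot (R : realType) (V : vectType R) (dot : {dot V for idfun})
  (e : seq V) i j : pair_ortho_rec dot e -> (i < j < size e)%N ->
  dot e`_i e`_j = 0.
Proof.
elim: e i j => [|x e IH] i j; first by rewrite ltn0 andbF.
move=> /andP[xe oe]; case: i j => [|i] [|j] //; rewrite ltnS /= => js.
  move: xe; rewrite /ortho_rec /= andbT => /allP /(_ e`_j).
  by move=> h; apply/eqP/h/mem_nth.
exact: IH.
Qed.

Lemma orthonormal_dot (R : realType) (V : vectType R) (dot : {dot V for idfun})
  (e : seq V) i j : orthonormal dot e -> (i < size e)%N -> (j < size e)%N ->
  dot e`_i e`_j = (i == j)%:R.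
Proof.
case/andP=> /allP one ortho ie je; case: (ltngtP i j) => [ij|ij|<-].
- by apply: pair_ortho_rec_dot => //; rewrite ij.
- by rewrite dot_sym; apply: pair_ortho_rec_dot => //; rewrite ij.
- by apply/eqP/one/mem_nth.
Qed.

Section Weights.
Variables (R : realType) (V : vectType R) (dot : {dot V for idfun}).
Variables (Phi Phip Pi : seq V) (k : V -> R).
Hypothesis rootPhi : root_system dot Phi.
Hypothesis posPhip : positive_system dot Phi Phip.
Hypothesis simplePi : simple_roots Phip Pi.
Variable e : seq V.
Hypothesis basis_e : basis_of fullv e.
Hypothesis ortho_e : orthonormal dot e.

Local Notation C := R[i].
Local Notation W := (weyl dot Phi).
Variable n : nat.
Local Notation M := 'M[C]_n.+1.
Variables (r : W -> M) (O : V -> M).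
Hypothesis r1 : r (weyl1 dot Phi) = 1%:M.
Hypothesis rM : forall u w, r (weylM u w) = r u *m r w.
Hypothesis irr : forall U : M, U != 0 -> (forall w, (U *m r w <= U)%MS) -> row_full U.
Hypothesis O_lin : forall (c : R) u v, O (c *: u + v) = (c%:C)%C *: O u + O v.
Hypothesis O_comm : forall u v, O u *m O v = O v *m O u.
Hypothesis O_cross : forall a (s : W) v, a \in Pi -> val s = refl dot a ->
  O v *m r s = r s *m O (refl dot a v) + ((k a * (2 * dot a v / dot a a))%:C)%C%:M.

Lemma basis_expand v : v = \sum_(i < size e) dot e`_i v *: e`_i.
Proof.
have /coord_basis/(_ (memvf v)) : basis_of fullv (in_tuple e) by [].
move=> vE; rewrite {1}vE; apply: eq_bigr => i _; congr (_ *: _).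
rewrite {2}vE linear_sumr (bigD1 i) //= big1 => [|j ji].
  by rewrite dotZr orthonormal_dot // eqxx mulr1 addr0.
by rewrite dotZr orthonormal_dot // (inj_eq val_inj) eq_sym (negPf ji) mulr0.
Qed.

Lemma riesz (f : V -> R) : (forall c u v, f (c *: u + v) = c * f u + f v) ->
  exists m, forall v, f v = dot m v.
Proof.
move=> flin; exists (\sum_(i < size e) f e`_i *: e`_i) => v.
have f0 : f 0 = 0 by have := flin (-1) 0 0; rewrite scaler0 addr0 mulN1r addNr.
have fsum (J : seq 'I_(size e)) (c : 'I_(size e) -> R) :
    f (\sum_(i <- J) c i *: e`_i) = \sum_(i <- J) c i * f e`_i.
  by elim: J => [|x J IH]; rewrite ?big_nil // !big_cons flin IH.
rewrite {1}(basis_expand v) fsum; symmetry.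
elim: (index_enum _) => [|x J IH]; first by rewrite !big_nil dot0l.
by rewrite !big_cons dotDl dotZl IH mulrC.
Qed.

Definition weight (x : 'rV[C]_n.+1) (lam : V -> C) :=
  x != 0 /\ forall v, x *m O v = lam v *: x.

Lemma weight_lin x lam c u v : weight x lam ->
  lam (c *: u + v) = (c%:C)%C * lam u + lam v.
Proof.
case=> x0 xl; apply/eqP; rewrite -subr_eq0; apply/eqP.
have : (lam (c *: u + v) - ((c%:C)%C * lam u + lam v)) *: x = 0.
  rewrite scalerBl -xl O_lin mulmxDr -scalemxAr !xl.
  by rewrite scalerDl scalerA subrr.
by move/eqP; rewrite scaler_eq0 (negPf x0) orbF => /eqP.
Qed.

Lemma weight_exists (U : M) : U != 0 -> (forall v, (U *m O v <= U)%MS) ->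
  exists x lam, weight x lam /\ (x <= U)%MS.
Proof.
move=> U0 stab.
have [||x [x0 xU xP]] := @common_eigenvector_sub _ _ [seq O v | v <- e] U U0.
- by move=> _ _ /mapP[u _ ->] /mapP[v _ ->]; rewrite /comm_mx O_comm.
- by move=> _ /mapP[u _ ->].
have O0 : O 0 = 0.
  by have := O_lin (-1) 0 0; rewrite scaler0 addr0 rmorphN1 scaleN1r addNr.
have xO v : exists a, x *m O v = a *: x.
  apply/sub_rVP; rewrite (basis_expand v).
  elim: (index_enum _) => [|i J IH]; first by rewrite big_nil O0 mulmx0 sub0mx.
  rewrite big_cons O_lin mulmxDr addmx_sub // -scalemxAr scalemx_sub //.
  by apply/xP/mapP; exists e`_i; rewrite ?mem_nth.
exists x, (fun v => projT1 (cid (xO v))); split=> //; split=> // v.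
by case: (cid _).
Qed.

(** The imaginary part of a weight is a real functional, represented by a vector through [dot] so
    that the Weyl group acts on it and norms can be compared. *)
Definition im_weight (m : V) :=
  exists x lam, weight x lam /\ forall v, complex.Im (lam v) = dot m v.

Lemma weight_im x lam : weight x lam ->
  exists2 m, im_weight m & forall v, complex.Im (lam v) = dot m v.
Proof.
move=> xl; have [|m mE] := @riesz (fun v => complex.Im (lam v)).
  move=> c u v; rewrite (weight_lin _ _ _ xl) raddfD /=; congr (_ + _).
  by case: (lam u) => a b /=; rewrite mul0r addr0.
by exists m => //; exists x, lam.
Qed.

(** There are finitely many candidates: [m] is determined by an eigenvalue of [O v] for each [v] in
    [e], and [mu] runs through all such choices. *)
Lemma im_weight_max m0 : im_weight m0 ->
  exists2 m, im_weight m & forall m', im_weight m' -> dot m' m' <= dot m m.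
Proof.
move=> Sm0.
pose rts (A : M) := sval (closed_field_poly_normal (char_poly A)).
have rtsP (A : M) a : eigenvalue A a -> a \in rts A.
  rewrite eigenvalue_root_char /rts; case: closed_field_poly_normal => s /= ->.
  rewrite (monicP (char_poly_monic _)) scale1r.
  by rewrite -root_prod_XsubC.
pose L := flatten [seq rts (O v) | v <- e].
pose mu (f : {ffun 'I_(size e) -> 'I_(size L)}) :=
  \sum_(i < size e) complex.Im (L`_(f i)) *: e`_i.
have muP m : im_weight m -> exists f, m = mu f.
  case=> x [lam [[x0 xl] lamE]].
  have idx (i : 'I_(size e)) : (index (lam (e`_i)%R) L < size L)%N.
    rewrite index_mem; apply/flattenP; exists (rts (O e`_i)).
      by apply/mapP; exists e`_i; rewrite ?mem_nth.
    by apply: rtsP; apply/eigenvalueP; exists x.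
  exists [ffun i => Ordinal (idx i)]; rewrite {1}(basis_expand m) /mu.
  apply: eq_bigr => i _; rewrite ffunE /= nth_index -?index_mem //.
  by rewrite lamE dot_sym.
have [f0 f0E] := muP _ Sm0.
have P0 : `[< im_weight (mu f0) >] by rewrite -f0E; apply/asboolP.
case: (@arg_maxP _ _ _ f0 (fun f => `[< im_weight (mu f) >])
  (fun f => dot (mu f) (mu f)) P0) => f /asboolP fS fmax.
exists (mu f) => // m' Sm'; have [g gE] := muP _ Sm'.
by rewrite gE; apply: fmax; rewrite -gE; apply/asboolP.
Qed.

Definition intertwiner (a : V) (s : W) : M := O a *m r s - ((k a)%:C)%C%:M.

Lemma O_sub c u v : O (u - c *: v) = O u - (c%:C)%C *: O v.
Proof. by rewrite addrC -scaleNr O_lin rmorphN scaleNr addrC. Qed.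

(** Moving [O v] to the left past [r s] creates [k a * c] times [O a], where
    [c = 2 * dot a v / dot a a]. Together with [- k a] times [O v] this is [- k a] times
    [O (refl dot a v)], because [refl dot a v = v - c *: a]. *)
Lemma intertwinerE a s v : a \in Pi -> val s = refl dot a ->
  intertwiner a s *m O v = O (refl dot a v) *m intertwiner a s.
Proof.
move=> aP sE; have a0 := root_neq0 rootPhi (simple_root posPhip simplePi aP).
rewrite /intertwiner mulmxBl mulmxBr -mulmxA.
have := O_cross (refl dot a v) aP sE; rewrite reflK => /(canLR (addrK _)) <-.
rewrite mulmxBr mulmxA O_comm -mulmxA -addrA -opprD; congr (_ - _).
rewrite !mul_mx_scalar mul_scalar_mx -(refl_dot dot a a v) refl_self dotNl.
rewrite [in RHS]reflE O_sub scalerBr scalerA -rmorphM addrC; congr (_ + _).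
by rewrite !(mulrN, mulNr) rmorphN scaleNr.
Qed.

(** The hypothesis says that [lam a] times [x *m r s] is [k a] times [x]. As [r s] squares to the
    identity, [lam a] is [k a] or [- k a], which is real. *)
Lemma intertwiner_ker a s x lam : a \in Pi -> val s = refl dot a ->
  weight x lam -> x *m intertwiner a s = 0 -> complex.Im (lam a) = 0.
Proof.
move=> aP sE [x0 xl]; rewrite /intertwiner mulmxBr mulmxA xl mul_mx_scalar.
rewrite -scalemxAl => /eqP; rewrite subr_eq0 => /eqP h.
have ss : r s *m r s = 1%:M by rewrite -{2}(weyl_reflV rootPhi sE) -rM weyl_mulV.
have h2 : lam a *: x = ((k a)%:C)%C *: (x *m r s).
  by rewrite scalemxAl -h -scalemxAl -mulmxA ss mulmx1.
have : (lam a ^+ 2 - ((k a)%:C)%C ^+ 2) *: x = 0.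
  rewrite scalerBl !expr2 -!scalerA h2 (scalerA (lam a)) [lam a * _]mulrC -scalerA.
  by rewrite h subrr.
move/eqP; rewrite scaler_eq0 (negPf x0) orbF subr_eq0 eqf_sqr.
by case/orP=> /eqP ->; rewrite //= oppr0.
Qed.

(** * The orbit of an imaginary part of maximal norm *)

Section Orbit.
Variables (ws : seq W) (u0 : V).
Hypothesis wsU : uniq ws.
Hypothesis wsP : forall w, w \in ws.
Hypothesis u0_wt : im_weight u0.
Hypothesis u0_max : forall m, im_weight m -> dot m m <= dot u0 u0.
Hypothesis u0_neq0 : u0 != 0.

Definition orbit_seq : seq V := undup [seq val (w : W) u0 | w <- ws].
Local Notation orb := orbit_seq.

Lemma orbitP v : reflect (exists w : W, v = val w u0) (v \in orb).
Proof.
rewrite mem_undup; apply: (iffP mapP) => [[w _ ->]|[w ->]]; first by exists w.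
by exists w.
Qed.

Lemma orbit_act v (w : W) : v \in orb -> val w v \in orb.
Proof.
by move=> /orbitP[z ->]; apply/orbitP; exists (weylM w z); rewrite weylME.
Qed.

Lemma orbit_norm v : v \in orb -> dot v v = dot u0 u0.
Proof. by move=> /orbitP[z ->]; rewrite weyl_dot. Qed.

(* The eigenvalues of all [O v], [v] in the orbit, are pooled so that one pair of
   polynomials serves every [v]: the intertwiners then carry [top_space v] into
   [top_space (refl dot a v)]. *)
Definition orbit_roots : seq C :=
  flatten [seq sval (closed_field_poly_normal (char_poly (O v))) | v <- orb].
Definition top_poly : {poly C} :=
  \prod_(z <- orbit_roots | complex.Im z == dot u0 u0) ('X - z%:P).
Definition low_poly : {poly C} :=
  \prod_(z <- orbit_roots | complex.Im z != dot u0 u0) ('X - z%:P).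

Lemma top_polyP z : top_poly.[z] = 0 -> complex.Im z = dot u0 u0.
Proof.
rewrite /top_poly -big_filter => /eqP; rewrite -[_ == 0]/(root _ z).
by rewrite root_prod_XsubC mem_filter => /andP[/eqP].
Qed.

Lemma low_polyP z : low_poly.[z] = 0 -> complex.Im z != dot u0 u0.
Proof.
rewrite /low_poly -big_filter => /eqP; rewrite -[_ == 0]/(root _ z).
by rewrite root_prod_XsubC mem_filter => /andP[].
Qed.

Lemma orbit_poly0 v : v \in orb -> horner_mx (O v) (low_poly * top_poly) = 0.
Proof.
move=> vo; have -> : low_poly * top_poly = \prod_(z <- orbit_roots) ('X - z%:P).
  by rewrite mulrC [RHS](bigID (fun z => complex.Im z == dot u0 u0)).
rewrite /orbit_roots big_flatten big_map (bigD1_seq v) ?undup_uniq //=.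
case: closed_field_poly_normal => s /= sE.
have -> : \prod_(z <- s) ('X - z%:P) = char_poly (O v).
  by rewrite [RHS]sE (monicP (char_poly_monic _)) scale1r.
by rewrite rmorphM /= Cayley_Hamilton mul0r.
Qed.

(** For [v] in the orbit, this is the sum of the generalized eigenspaces of [O v] for eigenvalues of
    imaginary part [dot u0 u0]; by [top_space_weight], all its weights have imaginary part [v]. *)
Definition top_space (v : V) : M := kermx (horner_mx (O v) top_poly).
Definition low_space (v : V) : M := kermx (horner_mx (O v) low_poly).

Lemma kermx_horner_stable p u v :
  (kermx (horner_mx (O u) p) *m O v <= kermx (horner_mx (O u) p))%MS.
Proof.
apply/sub_kermxP; rewrite -mulmxA -(horner_mx_intertwine _ (O_comm u v)).
by rewrite mulmxA mulmx_ker mul0mx.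
Qed.

Lemma kermx_horner_weight p u x lam : weight x lam ->
  (x <= kermx (horner_mx (O u) p))%MS -> p.[lam u] = 0.
Proof.
case=> x0 xl /sub_kermxP; rewrite (horner_mx_eigen _ (xl u)) => /eqP.
by rewrite scaler_eq0 (negPf x0) orbF => /eqP.
Qed.

(* Maximality of the norm: equality in Cauchy-Schwarz. *)
Lemma top_space_weight v x lam : v \in orb -> weight x lam ->
  (x <= top_space v)%MS -> forall u, complex.Im (lam u) = dot v u.
Proof.
move=> vo xl /(kermx_horner_weight xl)/top_polyP lv.
have [m Sm mE] := weight_im xl.
suff <- : m = v by [].
apply/eqP; rewrite -subr_eq0 -(dot_eq0 dot) eq_le dot_ge0 andbT.
rewrite dotBl !dotBr (dot_sym dot v m) -(mE v) lv (orbit_norm vo) subrr subr0.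
by rewrite subr_le0 u0_max.
Qed.

(** This lets disjointness of stable subspaces be tested on weights. *)
Lemma stable_cap (A B : M) : (forall v, A *m O v <= A)%MS ->
  (forall v, B *m O v <= B)%MS -> (A :&: B)%MS != 0 ->
  exists x lam, [/\ weight x lam, (x <= A)%MS & (x <= B)%MS].
Proof.
move=> sA sB /weight_exists[v|x [lam [xl]]].
  rewrite sub_capmx (submx_trans (submxMr _ (capmxSl _ _)) (sA v)).
  exact: submx_trans (submxMr _ (capmxSr _ _)) (sB v).
by rewrite sub_capmx => /andP[xA xB]; exists x, lam.
Qed.

Lemma top_low_cap v : (top_space v :&: low_space v)%MS = 0.
Proof.
apply/eqP; apply: contraT => /stable_cap[||x [lam [xl]]];
  try exact: kermx_horner_stable.
move=> /(kermx_horner_weight xl)/top_polyP h.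
by move=> /(kermx_horner_weight xl)/low_polyP; rewrite h eqxx.
Qed.

(** A common weight would have imaginary part both [u] and [v], so the two top spaces meet
    trivially. Applying [low_poly] of [O u] to [top_space v] lands in both of them, hence gives
    zero. *)
Lemma top_sub_low u v : u \in orb -> v \in orb -> u != v ->
  (top_space v <= low_space u)%MS.
Proof.
move=> uo vo uv; have cap0 : (top_space v :&: top_space u)%MS = 0.
  apply/eqP; apply: contraT => /stable_cap[||x [lam [xl xv xu]]];
    try exact: kermx_horner_stable.
  case/eqP: uv; apply/eqP; rewrite -subr_eq0 -(dot_eq0 dot) dotBl.
  by rewrite -(top_space_weight uo xl xu) -(top_space_weight vo xl xv) subrr.
apply/sub_kermxP/eqP; rewrite -submx0 -cap0 sub_capmx; apply/andP; split.
  apply/sub_kermxP; rewrite -mulmxA.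
  rewrite -(horner_mx_intertwine (A := O v) (B := O v)).
    by rewrite mulmxA mulmx_ker mul0mx.
  by rewrite -(horner_mx_intertwine _ (O_comm u v)).
apply/sub_kermxP; rewrite -mulmxA; have := orbit_poly0 uo.
by rewrite rmorphM /= -mulmxE => ->; rewrite mulmx0.
Qed.

(** If [s] moves [v], the intertwiner is injective on [top_space v]: a weight [lam] in its kernel
    would have [lam a] real, whereas the imaginary part is [dot v a]. *)
Lemma rank_top_simple a (s : W) v : a \in Pi -> val s = refl dot a -> v \in orb ->
  (\rank (top_space v) <= \rank (top_space (val s v)))%N.
Proof.
move=> aP sE vo; have [av|av] := eqVneq (dot a v) 0.
  by rewrite sE refl_orth.
have <- : \rank (top_space v *m intertwiner a s) = \rank (top_space v).
  apply/mxrank_injP; apply: contraT => /stable_cap[u|u|x [lam [xl xv xk]]].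
  - exact: kermx_horner_stable.
  - apply/sub_kermxP; rewrite -mulmxA -[u](reflK dot a).
    by rewrite -intertwinerE // mulmxA mulmx_ker mul0mx.
  - have := intertwiner_ker aP sE xl (sub_kermxP xk).
    by rewrite (top_space_weight vo xl xv) dot_sym => /eqP; rewrite (negPf av).
apply/mxrankS/sub_kermxP; rewrite -mulmxA sE.
rewrite -(horner_mx_intertwine (A := O v) (B := O (refl dot a v))).
  by rewrite mulmxA mulmx_ker mul0mx.
by rewrite (intertwinerE _ aP sE) reflK.
Qed.

Lemma rank_top v (w : W) : v \in orb ->
  (\rank (top_space v) <= \rank (top_space (val w v)))%N.
Proof.
move=> vo; elim/(weyl_ind rootPhi posPhip simplePi): w => [|s a w aP sE IH].
  by rewrite weyl1E.
by rewrite weylME; apply: leq_trans IH (rank_top_simple aP sE (orbit_act _ vo)).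
Qed.

Lemma rank_top_gt0 v : v \in orb -> (0 < \rank (top_space v))%N.
Proof.
move=> /orbitP[w ->]; have u0o : u0 \in orb.
  by apply/orbitP; exists (weyl1 dot Phi); rewrite weyl1E.
rewrite (leq_trans _ (rank_top w u0o)) // lt0n mxrank_eq0.
have [x [lam [xl lamE]]] := u0_wt.
apply: contraTneq (xl.1) => top0; rewrite negbK -submx0 -top0.
apply/sub_kermxP; rewrite (horner_mx_eigen _ (xl.2 u0)).
suff -> : top_poly.[lam u0] = 0 by rewrite scale0r.
apply/eqP; rewrite -[_ == 0]/(root _ _) /top_poly -big_filter.
rewrite root_prod_XsubC mem_filter lamE eqxx /=; apply/flattenP.
eexists; first by apply/mapP; exists u0.
case: closed_field_poly_normal => s /= sE; rewrite -root_prod_XsubC.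
move: sE; rewrite (monicP (char_poly_monic _)) scale1r => <-.
by rewrite -eigenvalue_root_char; apply/eigenvalueP; exists x; [apply: xl.2|apply: xl.1].
Qed.

(** * Induction from the stabilizer of a dominant orbit point *)

Variable u : V.
Hypothesis u_orb : u \in orb.
Hypothesis u_dom : forall a, a \in Pi -> 0 <= dot a u.

(** By dominance, the stabilizer is generated by simple reflections orthogonal to [u]. For these the
    scalar in the cross relation vanishes, so [r s] commutes with [O u]. *)
Lemma top_space_stab (w : W) : val w u = u ->
  (top_space u *m r w <= top_space u)%MS.
Proof.
move: w; apply: (weyl_stab_ind rootPhi posPhip simplePi u_dom) => [|s a w aP au sE IH].
  by rewrite r1 mulmx1.
rewrite rM mulmxA (submx_trans (submxMr _ _) IH) //.
apply/sub_kermxP; rewrite -mulmxA.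
rewrite -(horner_mx_intertwine (A := O u) (B := O u)).
  by rewrite mulmxA mulmx_ker mul0mx.
by rewrite (O_cross u aP sE) refl_orth // au mulr0 mul0r mulr0 rmorph0 addr0.
Qed.

Lemma orbit_rep o : o \in orb -> exists w : W, val (weylV w) u = o.
Proof.
move=> /orbitP[z' ->]; have /orbitP[z uE] := u_orb.
exists (weylM z (weylV z')).
by rewrite weyl_invM // weyl_invK // weylME uE weylVK.
Qed.

(** Matrices act on the right, so [top_space u *m r w] depends only on [val (weylV w) u]; hence the
    inverse. The unit is a default value off the orbit. *)
Definition coset_rep (o : V) : W :=
  if pselect (exists w : W, val (weylV w) u = o) is left h then projT1 (cid h)
  else weyl1 dot Phi.

Definition block (o : V) : M := top_space u *m r (coset_rep o).

Definition other_blocks : M := (\sum_(o <- orb | o != u) block o)%MS.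

Lemma coset_repE o : o \in orb -> val (weylV (coset_rep o)) u = o.
Proof.
by move=> /orbit_rep h; rewrite /coset_rep; case: pselect => // h'; case: cid.
Qed.

Lemma weylV_orb (w : W) : val (weylV w) u \in orb.
Proof. exact: orbit_act. Qed.

Lemma top_move_other (w : W) : val (weylV w) u != u ->
  (top_space u *m r w <= other_blocks)%MS.
Proof.
set o := val (weylV w) u => ou; have oO : o \in orb by apply: weylV_orb.
pose z := weylM w (weylV (coset_rep o)).
have -> : w = weylM z (coset_rep o).
  by rewrite /z -weyl_mulA weyl_mulVl // weyl_mulr1.
have zu : val z u = u by rewrite weylME coset_repE // weylKV.
rewrite rM mulmxA (submx_trans (submxMr _ (top_space_stab zu))) //.
rewrite /other_blocks -big_filter (bigD1_seq o) ?filter_uniq ?undup_uniq //=.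
  exact: addsmxSl.
by rewrite mem_filter ou.
Qed.

Lemma top_move (w : W) : val (weylV w) u = u -> (top_space u *m r w <= top_space u)%MS.
Proof. by move=> wu; apply: top_space_stab; rewrite -[in LHS]wu weylKV. Qed.

(** The sum contains every translate of [top_space u] and is spanned by translates, so it is stable;
    it is nonzero, hence everything by irreducibility. *)
Lemma blocks_full : row_full (top_space u + other_blocks)%MS.
Proof.
have all_sub w : (top_space u *m r w <= top_space u + other_blocks)%MS.
  have [wu|wu] := eqVneq (val (weylV w) u) u.
    exact: submx_trans (top_move wu) (addsmxSl _ _).
  exact: submx_trans (top_move_other wu) (addsmxSr _ _).
apply: irr => [|w].
  apply: contraTneq (rank_top_gt0 u_orb) => h.
  rewrite -leqNgt leqn0 mxrank_eq0 -submx0 -h; exact: addsmxSl.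
rewrite addsmxMr addsmx_sub all_sub /=.
rewrite /other_blocks; apply: (big_ind (fun A : M => (A *m r w <= _)%MS)).
- by rewrite mul0mx sub0mx.
- by move=> A B hA hB; rewrite addsmxMr addsmx_sub hA.
- by move=> o _; rewrite /block -mulmxA -rM.
Qed.

(** The other top spaces all lie in [low_space v], which meets [top_space v] trivially. *)
Lemma rank_top_sum l : uniq l -> {subset l <= orb} ->
  \rank (\sum_(v <- l) top_space v)%MS = (\sum_(v <- l) \rank (top_space v))%N.
Proof.
elim: l => [|v l IH] /=; first by rewrite !big_nil mxrank0.
move=> /andP[vl ul] sub; rewrite !big_cons.
have vo : v \in orb by apply: sub; rewrite mem_head.
have lo : {subset l <= orb} by move=> x xl; apply: sub; rewrite inE xl orbT.
rewrite mxrank_disjoint_sum ?IH //; apply/eqP.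
rewrite -submx0 -[X in (_ <= X)%MS](top_low_cap v) capmxS // big_seq.
apply: sumsmx_seq_sub => x xl; apply: (top_sub_low vo (lo _ xl)).
by apply: contraNneq vl => ->.
Qed.

(** Dimension count. The top spaces along the orbit are independent of rank at least [d], so [d]
    times the size of the orbit is at most [n.+1]. Each block has rank at most [d] and the blocks
    span everything, so [top_space u] meets the others trivially. *)
Lemma blocks_cap : (top_space u :&: other_blocks)%MS = 0.
Proof.
apply/eqP; rewrite -mxrank_eq0 -leqn0.
have := mxrank_sum_cap (top_space u) other_blocks.
have /eqP -> := blocks_full.
pose d := \rank (top_space u).
have le1 : (\rank other_blocks <= \sum_(o <- orb | o != u) d)%N.
  rewrite /other_blocks; apply: (big_ind2 (fun (A : M) m => (\rank A <= m)%N)).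
  - by rewrite mxrank0.
  - move=> A m B m' hA hB.
    exact: leq_trans (mxrank_adds_leqif A B) (leq_add hA hB).
  - by move=> o _; apply: mxrankM_maxl.
have : (d + \sum_(o <- orb | o != u) d <= n.+1)%N.
  apply: leq_trans (rank_leq_col (\sum_(v <- orb) top_space v)%MS).
  have orbU : uniq orb by exact: undup_uniq.
  have -> := rank_top_sum orbU (fun _ h => h).
  rewrite (bigD1_seq u u_orb orbU) /= leq_add2l.
  rewrite big_seq_cond [X in (_ <= X)%N]big_seq_cond.
  apply: leq_sum => v /andP[vo _].
  have [w <-] := orbit_rep vo; exact: rank_top.
rewrite -/d; move: le1; set A := \rank _; set B := \rank _; set S := (\sum_(_ <- _ | _) _)%N.
lia.
Qed.

(** Mackey's criterion made explicit. The sum of the conjugates of [q *m r s] is a scalar by Schur,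
    and zero because [q *m r s] has trace zero. Yet applied to a vector [x] of [top_space u] and
    followed by [r s *m q], it gives a positive multiple of [x]. *)
Lemma orbit_contradiction : False.
Proof.
have u0' : u != 0.
  by rewrite -(dot_eq0 dot) orbit_norm // dot_eq0.
have [a aP au] : exists2 a, a \in Pi & dot a u != 0.
  apply: contrapT => no; case/eqP: u0'; apply/eqP; rewrite -(dot_eq0 dot).
  have [bPi _ _] := simplePi.
  have /coord_basis/(_ (memvf u)) uE : basis_of fullv (in_tuple Pi) by [].
  rewrite {2}uE linear_sumr big1 // => i _ /=; rewrite dotZr dot_sym.
  have [->|nz] := eqVneq (dot (in_tuple Pi)`_i u) 0; first by rewrite mulr0.
  by case: no; exists (in_tuple Pi)`_i => //; rewrite mem_nth.
have [s sE] := refl_weylP dot (simple_root posPhip simplePi aP).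
have sV := weyl_reflV rootPhi sE.
have a0 := root_neq0 rootPhi (simple_root posPhip simplePi aP).
pose t := 2 * dot a u / dot a a.
have t0 : t != 0 by rewrite !mulf_neq0 ?invr_eq0 ?dot_eq0 ?pnatr_eq0.
have su : val s u = u - t *: a by rewrite sE reflE.
have suu : val s u != u.
  by rewrite su -subr_eq0 addrAC subrr sub0r oppr_eq0 scaler_eq0 (negPf t0).
(* [s] moves [u], so [r s] sends [top_space u] into the other blocks, which [q] kills; whence
   [qsq]. *)
pose q : M := proj_mx (top_space u) other_blocks.
have q_id (x : 'rV_n.+1) : (x <= top_space u)%MS -> x *m q = x.
  exact: proj_mx_id blocks_cap.
have q_0 m (A : 'M_(m, n.+1)) : (A <= other_blocks)%MS -> A *m q = 0.
  exact: proj_mx_0 blocks_cap.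
have qsq : q *m r s *m q = 0.
  apply: q_0; apply: submx_trans (top_move_other (w := s) _).
    by rewrite submxMr // -[q]mul1mx proj_mx_sub.
  by rewrite sV.
have trq : \tr (q *m r s) = 0.
  have <- : q *m q = q by apply: proj_mx_proj blocks_cap.
  by rewrite -mulmxA mxtrace_mulC qsq mxtrace0.
clearbody q; have := schur_average rootPhi wsU wsP r1 rM irr (q *m r s).
rewrite trq mulr0 mul0r rmorph0 => avg.
pose x := nz_row (top_space u).
have x0 : x != 0 by rewrite nz_row_eq0 -mxrank_eq0 -lt0n rank_top_gt0.
have xtop : (x <= top_space u)%MS by apply: nz_row_sub.
pose z w := weylM (weylM w s) (weylM (weylV w) s).
pose fix_ w := (val (weylV w) u == u) && (val (weylV (z w)) u == u).
(* A term survives only if [w] and [z w] both fix [u]. Then [w] fixes [u] and [val s u], hence [a];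
   so it commutes with [s], and [z w] is the unit. *)
have term w : x *m (r w *m (q *m r s) *m r (weylV w)) *m (r s *m q) =
              if fix_ w then x else 0.
  rewrite /fix_; have [wu|wu] /= := eqVneq (val (weylV w) u) u; last first.
    rewrite !mulmxA (q_0 _ (x *m r w)) ?mul0mx //.
    exact: submx_trans (submxMr _ xtop) (top_move_other wu).
  rewrite !mulmxA (q_id (x *m r w)); last exact: submx_trans (submxMr _ xtop) (top_move wu).
  have -> : x *m r w *m r s *m r (weylV w) *m r s = x *m r (z w).
    by rewrite /z !rM !mulmxA.
  have [zu|zu] := eqVneq (val (weylV (z w)) u) u; last first.
    by rewrite q_0 //; apply: submx_trans (submxMr _ xtop) (top_move_other zu).
  have wu' : val w u = u by rewrite -[in LHS]wu weylKV.
  have wsu : val w (val s u) = val s u.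
    move: zu; rewrite /z !weyl_invM // weyl_invK // sV !weylME wu => zu.
    by rewrite -[in RHS]zu sE reflK.
  have wa : val w a = a.
    move: wsu; rewrite su linearB linearZ /= wu' => /addrI/oppr_inj.
    exact: scalerI.
  have -> : z w = weyl1 dot Phi.
    have ws_sw : weylM w s = weylM s w.
      apply: weyl_ext => v; rewrite !weylME sE -[in RHS]wa -!comp_lfunE.
      by rewrite (refl_conj _ (weyl_dot rootPhi w)).
    rewrite /z ws_sw -weyl_mulA (weyl_mulA w) weyl_mulV // weyl_mul1.
    by rewrite -{2}sV weyl_mulV.
  by rewrite r1 mulmx1 q_id.
(* The sum is [x] times the number of [w] satisfying [fix_], and the unit is one of them. *)
have := congr1 (fun A : M => x *m A *m (r s *m q)) avg.
rewrite mulmx0 mul0mx mulmx_sumr mulmx_suml (eq_bigr _ (fun w _ => term w)).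
rewrite -big_mkcond big_const_seq iter_addr_0 -scaler_nat => /eqP.
rewrite scaler_eq0 (negPf x0) orbF pnatr_eq0 -leqn0 leqNgt -has_count.
case/hasP; exists (weyl1 dot Phi) => //; rewrite /fix_ /z weyl_inv1 //.
by rewrite !weyl_mul1 -{2}sV weyl_mulV // weyl_inv1 // weyl1E eqxx.
Qed.

End Orbit.

Lemma im_weight_eq0 m : im_weight m -> m = 0.
Proof.
move=> Sm; have [u0 Su0 u0max] := im_weight_max Sm.
have [ws [wsU wsP]] := weyl_finite rootPhi.
have u00 : u0 = 0.
  apply/eqP; apply: contraT => u0n.
  have [w dom] := dominant_conj rootPhi posPhip simplePi u0.
  have uo : val w u0 \in orbit_seq ws u0 by apply/(orbitP _ wsP); exists w.
  by case: (orbit_contradiction wsU wsP Su0 u0max u0n uo dom).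
apply/eqP; rewrite -(dot_eq0 dot) eq_le dot_ge0 andbT.
by have := u0max m Sm; rewrite u00 linear0r.
Qed.

(** The eigenspace is stable under every [O u], so it contains a weight vector, and weights have
    zero imaginary part. *)
Lemma eigenvalue_real v a : eigenvalue (O v) a -> a \is Num.real.
Proof.
move=> ev; have [|x [lam [xl xE]]] := @weight_exists (eigenspace (O v) a) ev.
  by move=> u; apply: comm_mx_stable_eigenspace; rewrite /comm_mx O_comm.
have lv : lam v = a.
  have /eigenspaceP := xE; rewrite xl.2 => /eqP.
  by rewrite -subr_eq0 -scalerBl scaler_eq0 (negPf xl.1) orbF subr_eq0 => /eqP.
have [m /im_weight_eq0 m0 mE] := weight_im xl.
have : complex.Im a = 0 by rewrite -lv mE m0 linear0l.
by case: (a) => b c /= ->; apply/complex_realP; exists b.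
Qed.

Lemma dominant_comm (w : W) v : (forall a, a \in Pi -> 0 <= dot a v) ->
  val w v = v -> r w *m O v = O v *m r w.
Proof.
move=> dom; move: w.
apply: (weyl_stab_ind rootPhi posPhip simplePi dom) => [|s a w aP av sE IH].
  by rewrite r1 mul1mx mulmx1.
rewrite rM -mulmxA IH !mulmxA; congr (_ *m _).
by rewrite (O_cross v aP sE) refl_orth // av mulr0 mul0r mulr0 rmorph0 addr0.
Qed.

(** * Traces of the difference between a family and its adjoint *)

Variable O' : V -> M.
Hypothesis O'_lin : forall (c : R) u v, O' (c *: u + v) = (c%:C)%C *: O' u + O' v.
Hypothesis O'_cross : forall a (s : W) v, a \in Pi -> val s = refl dot a ->
  O' v *m r s = r s *m O' (refl dot a v) + ((k a * (2 * dot a v / dot a a))%:C)%C%:M.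
Hypothesis O'_trace : forall w v, \tr (r w *m O' v) = (\tr (r (weylV w) *m O v))^*.

(** The scalar terms of the two cross relations agree and cancel in the difference. *)
Lemma sub_equivariant (w : W) v :
  (O v - O' v) *m r w = r w *m (O (val (weylV w) v) - O' (val (weylV w) v)).
Proof.
elim/(weyl_ind rootPhi posPhip simplePi): w v => [|s a w aP sE IH] v.
  by rewrite r1 mulmx1 mul1mx weyl_inv1 // weyl1E.
rewrite rM mulmxA; have -> : (O v - O' v) *m r s = r s *m (O (val s v) - O' (val s v)).
  rewrite mulmxBl mulmxBr !(O_cross v aP sE) !(O'_cross v aP sE) sE.
  by rewrite opprD addrACA subrr addr0.
by rewrite -mulmxA IH mulmxA weyl_invM // (weyl_reflV rootPhi sE) weylME.
Qed.

(** [r w] has finite order and commutes with [O v], whose eigenvalues are real, so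
    [trace_torsion_real] matches [O'_trace]. *)
Lemma trace_sub_dominant (w : W) v : (forall a, a \in Pi -> 0 <= dot a v) ->
  val w v = v -> \tr (r w *m (O v - O' v)) = 0.
Proof.
move=> dom wv; have [m m0 wm] := weyl_order rootPhi w.
rewrite mulmxBr linearB /= O'_trace -(@trace_torsion_real _ _ (r w) _ _ m) ?subrr //.
- by rewrite -rM weyl_mulV.
- rewrite -[RHS]r1 -wm; elim: (m) => [|j IH]; first by rewrite expr0 /= r1.
  by rewrite exprS IH /= rM.
- exact: dominant_comm.
- exact: eigenvalue_real.
Qed.

Lemma trace_sub_conj (w g : W) v :
  \tr (r (weylM g (weylM w (weylV g))) *m (O (val g v) - O' (val g v))) =
  \tr (r w *m (O v - O' v)).
Proof.
have /(congr1 (fun A => A *m r (weylV g))) := sub_equivariant g (val g v).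
rewrite weylVK // -!mulmxA -rM weyl_mulV // r1 mulmx1 => ->.
rewrite !rM -!mulmxA (mulmxA (r (weylV g))) -rM weyl_mulVl // r1 mul1mx.
by rewrite mxtrace_mulC -!mulmxA -rM weyl_mulVl // r1 mulmx1.
Qed.

Lemma trace_sub_fixed (w : W) v : val w v = v -> \tr (r w *m (O v - O' v)) = 0.
Proof.
move=> wv; have [g dom] := dominant_conj rootPhi posPhip simplePi v.
rewrite -(trace_sub_conj w g); apply: trace_sub_dominant => //.
by rewrite !weylME weylVK // wv.
Qed.

(* Averaging [v] over the powers of [w] does not change the trace. *)
Lemma trace_sub (w : W) v : \tr (r w *m (O v - O' v)) = 0.
Proof.
pose f x := \tr (r w *m (O x - O' x)).
have f_lin c x y : f (c *: x + y) = (c%:C)%C * f x + f y.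
  rewrite /f O_lin O'_lin opprD addrACA -scalerBr mulmxDr -scalemxAr linearD.
  by rewrite linearZ.
have f_step x : f (val w x) = f x.
  by rewrite /f mxtrace_mulC sub_equivariant weylVK.
have f0 : f 0 = 0.
  by have := f_lin (-1) 0 0; rewrite scaler0 addr0 rmorphN1 mulN1r addNr.
have [[//|m] _ wm] := weyl_order rootPhi w.
pose avg := \sum_(i < m.+1) iter i (val w) v.
have avgE : f avg = m.+1%:R * f v.
  rewrite /avg mulr_natl; elim: m.+1 => [|j IH]; first by rewrite big_ord0.
  rewrite big_ord_recr /= mulrSr -IH addrC -[X in f (X + _)]scale1r f_lin.
  rewrite rmorph1 mul1r addrC; congr (_ + _).
  by elim: (j) => // i <-; rewrite iterS f_step.
have : f avg = 0.
  apply: trace_sub_fixed; rewrite /avg linear_sum /=.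
  (* The power [m.+1] of [w] is the unit, so applying [w] shifts the sum cyclically. *)
  rewrite big_ord_recr /= big_ord_recl addrC /=.
  by rewrite -[val w _]/(iter m.+1 (val w) v) -weyl_expE wm weyl1E.
by rewrite avgE => /eqP; rewrite mulf_eq0 pnatr_eq0 => /eqP.
Qed.

Lemma adjoint_family_mx_eq v : O v = O' v.
Proof.
have [ws [wsU wsP]] := weyl_finite rootPhi.
apply/eqP; rewrite -subr_eq0; apply/eqP.
apply: (trace_separates rootPhi wsU wsP r1 rM irr) => w; exact: trace_sub.
Qed.

End Weights.

(** * Coordinates and adjoints *)

Section Coordinates.
Variables (K : fieldType) (X : lmodType K).

Definition spanning n (b : 'I_n -> X) :=
  forall x, exists c : 'I_n -> K, x = \sum_i c i *: b i.

Lemma spanning_drop n (b : 'I_n.+1 -> X) (c : 'I_n.+1 -> K) j :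
  spanning b -> \sum_i c i *: b i = 0 -> c j != 0 ->
  spanning (fun i => b (lift j i)).
Proof.
move=> bs c0 cj x; have [d xE] := bs x.
exists (fun i => d (lift j i) - d j / c j * c (lift j i)).
have : x = \sum_i (d i - d j / c j * c i) *: b i.
  under eq_bigr do rewrite scalerBl -scalerA.
  by rewrite sumrB -scaler_sumr c0 scaler0 subr0.
by rewrite (bigD1_ord j) //= divfK // subrr scale0r add0r.
Qed.

(** [X] is a bare module, so a basis is extracted from a spanning family by dropping redundant
    vectors. *)
Lemma basis_exists n (b : 'I_n -> X) : spanning b ->
  exists m (b' : 'I_m -> X), spanning b' /\
    forall c, \sum_i c i *: b' i = 0 -> forall i, c i = 0.
Proof.
elim: n b => [|n IH] b bs; first by exists 0%N, b; split=> // c _ [].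
have [dep|indep] := pselect (exists c j, \sum_i c i *: b i = 0 /\ c j != 0).
  by have [c [j [c0 cj]]] := dep; apply: IH (spanning_drop bs c0 cj).
exists n.+1, b; split=> // c c0 i; apply: contrapT => /eqP ci.
by apply: indep; exists c, i.
Qed.

Variables (n : nat) (b : 'I_n -> X).
Hypothesis b_span : spanning b.
Hypothesis b_free : forall c, \sum_i c i *: b i = 0 -> forall i, c i = 0.

Lemma coords_exist x : exists c : 'rV[K]_n, \sum_i c 0 i *: b i = x.
Proof.
have [c ->] := b_span x; exists (\row_i c i).
by apply: eq_bigr => i _; rewrite mxE.
Qed.

Definition coords (x : X) : 'rV[K]_n := projT1 (cid (coords_exist x)).

Lemma coordsK x : \sum_i coords x 0 i *: b i = x.
Proof. by rewrite /coords; case: (cid _). Qed.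

Lemma coords_unique x (c : 'rV[K]_n) : \sum_i c 0 i *: b i = x -> coords x = c.
Proof.
move=> cE; apply/rowP => i; apply/eqP; rewrite -subr_eq0; apply/eqP.
apply: (b_free (c := fun i => coords x 0 i - c 0 i)).
under eq_bigr do rewrite scalerBl.
by rewrite sumrB coordsK cE subrr.
Qed.

Lemma coords_lin a x y : coords (a *: x + y) = a *: coords x + coords y.
Proof.
apply: coords_unique; under eq_bigr do rewrite !mxE scalerDl -scalerA.
by rewrite big_split -scaler_sumr !coordsK.
Qed.

Lemma coords0 : coords 0 = 0.
Proof.
by apply: coords_unique; rewrite big1 // => i _; rewrite mxE scale0r.
Qed.

Definition decode (c : 'rV[K]_n) : X := \sum_i c 0 i *: b i.

Lemma decodeK c : coords (decode c) = c.
Proof. exact: coords_unique. Qed.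

(** Rows are the images of basis vectors, so composition of maps becomes the product in the opposite
    order. *)
Definition mat (f : X -> X) : 'M[K]_n := \matrix_(i, j) coords (f (b i)) 0 j.

Lemma mat_row f i : row i (mat f) = coords (f (b i)).
Proof. by apply/rowP => j; rewrite !mxE. Qed.

Lemma matE (f : {linear X -> X}) x : coords (f x) = coords x *m mat f.
Proof.
rewrite mulmx_sum_row; apply: coords_unique; rewrite -{2}(coordsK x) linear_sum.
under eq_bigr do rewrite summxE scaler_suml.
rewrite exchange_big /=; apply: eq_bigr => i _.
rewrite linearZ /= -(coordsK (f (b i))) scaler_sumr; apply: eq_bigr => j _.
by rewrite mat_row mxE scalerA.
Qed.

Lemma mat_unique (f : X -> X) (A : 'M[K]_n) :
  (forall x, coords (f x) = coords x *m A) -> mat f = A.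
Proof.
move=> fA; apply/row_matrixP => i; rewrite mat_row fA rowE; congr (_ *m _).
apply: coords_unique; rewrite (bigD1 i) //= big1 ?addr0 => [|j /negPf ji].
  by rewrite mxE !eqxx scale1r.
by rewrite mxE ji andbF scale0r.
Qed.

End Coordinates.

Lemma tens0l (K : fieldType) (X Y : lmodType K) (y : Y) : tens (0 : X) y = 0.
Proof.
have := tensDl 1 (0 : X) 0 y; rewrite !scale1r addr0 => /eqP.
by rewrite -subr_eq0 opprD addNKr oppr_eq0 => /eqP.
Qed.

Lemma tensor_map0l (K : fieldType) (X X' Y Y' : lmodType K)
  (f : {linear X -> X'}) (g : {linear Y -> Y'}) z :
  (forall x, f x = 0) -> tensor_map f g z = 0.
Proof.
move=> f0; rewrite -[z]quotmod_classK tensor_map_class.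
have L (h := fun p : X * Y => tens (f p.1) (g p.2)) (c : K) (u v : {freeg (X * Y) / K}) :
  fglift h (c *: u + v) = c *: fglift h u + fglift h v.
  exact: fglift_linear.
set h := fun p : X * Y => _.
have h0 : fglift h 0 = 0.
  by have := L (-1) 0 0; rewrite !scaleN1r oppr0 addNr addr0.
rewrite -[repr z]freeg_sumE; elim: (dom _) => [|p s IH].
  by rewrite big_nil.
rewrite big_cons -[X in X + _]scale1r L IH addr0 liftU /h f0 tens0l.
by rewrite !scaler0.
Qed.

(** * Cohomology of the zero operator *)

Section ZeroCohomology.
Variables (K : fieldType) (Y : lmodType K) (D : {linear Y -> Y}).
Hypothesis D0 : forall y, D y = 0.

Lemma ker_predT y : ker_pred D y.
Proof. by rewrite /ker_pred /= D0. Qed.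

Lemma cohomology_class_val (x y : ker D) :
  cohomology_class x = cohomology_class y -> val x = val y.
Proof.
move=> /quotmod_eqP; rewrite inE => /asboolP[z]; rewrite D0 raddfB => /esym/eqP.
by rewrite subr_eq0 => /eqP.
Qed.

(** The image of [D] is zero, so classes are single elements and the choice of representative is
    harmless. *)
Definition cohomology_val (u : cohomology D) : Y := val (repr u).

Lemma cohomology_valE (y : ker D) : cohomology_val (cohomology_class y) = val y.
Proof. by apply: cohomology_class_val; apply: quotmod_classK. Qed.

Lemma cohomology_val_linear : linear cohomology_val.
Proof.
move=> c u v; rewrite -[u]quotmod_classK -[v]quotmod_classK -linearP.
by rewrite !cohomology_valE linearP.
Qed.

Lemma cohomology_val_bij : bijective cohomology_val.
Proof.
exists (fun y => cohomology_class (Sub y (ker_predT y) : ker D)) => [u|y].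
  rewrite -[RHS]quotmod_classK; congr cohomology_class; exact: val_inj.
by rewrite cohomology_valE SubK.
Qed.

Lemma zero_cohomology : exists phi : {linear cohomology D -> Y},
  bijective phi /\ forall y : ker D, phi (cohomology_class y) = val y.
Proof.
pose L := GRing.isLinear.Build K (cohomology D) Y *:%R _ cohomology_val_linear.
pose phi : {linear cohomology D -> Y} := HB.pack cohomology_val L.
exists phi; split; first exact: cohomology_val_bij.
exact: cohomology_valE.
Qed.

End ZeroCohomology.

(** The Gram matrix [H] is invertible by nondegeneracy, and adjointness says that it conjugates the
    matrix of [f] into the conjugate transpose of that of [g]. *)
Lemma adjoint_trace (C : numClosedFieldType) (X : lmodType C) n (b : 'I_n -> X)
  (bs : spanning b) (bf : forall c, \sum_i c i *: b i = 0 -> forall i, c i = 0)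
  (B : {hermitian_sym X for Num.conj_op}) (f g : {linear X -> X}) :
  (forall x, (forall y, B x y = 0) -> x = 0) ->
  (forall x y, B (f x) y = B x (g y)) ->
  \tr (mat bs f) = (\tr (mat bs g))^*.
Proof.
move=> nd adj; pose H := \matrix_(i, j) B (b i) (b j).
have Bl (c : 'rV_n) y : B (\sum_i c 0 i *: b i) y = \sum_i c 0 i * B (b i) y.
  have add x z : B (x + z) y = B x y + B z y by exact: linearDl.
  have scale a x : B (a *: x) y = a * B x y by exact: linearZl_LR.
  elim: (index_enum _) => [|i s IH]; first by rewrite !big_nil linear0l.
  by rewrite !big_cons add IH scale.
have Br (c : 'rV_n) y : B y (\sum_i c 0 i *: b i) = \sum_i (c 0 i)^* * B y (b i).
  have add x z : B y (x + z) = B y x + B y z by exact: linearDr.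
  have scale a x : B y (a *: x) = a^* * B y x by exact: linearZr_LR.
  elim: (index_enum _) => [|i s IH]; first by rewrite !big_nil linear0r.
  by rewrite !big_cons add IH scale.
have Hu : H \in unitmx.
  rewrite -row_free_unit -kermx_eq0; apply/rowV0P => c /sub_kermxP cH.
  apply: (can_inj (decodeK bs bf)); rewrite [RHS]big1 => [|i _]; last first.
    by rewrite mxE scale0r.
  apply: nd => y; rewrite -(coordsK bs y) Br big1 // => j _.
  rewrite Bl (_ : \sum_i _ = (c *m H) 0 j); first by rewrite cH mxE mulr0.
  by rewrite mxE; apply: eq_bigr => i _; rewrite mxE.
have fH : mat bs f *m H = H *m map_mx Num.conj_op (mat bs g)^T.
  apply/matrixP => i j; have := adj (b i) (b j).
  rewrite -(coordsK bs (f (b i))) -(coordsK bs (g (b j))) Bl Br.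
  rewrite !mxE => E; transitivity (\sum_l coords bs (f (b i)) 0 l * B (b l) (b j)).
    by apply: eq_bigr => l _; rewrite !mxE.
  by rewrite E; apply: eq_bigr => l _; rewrite !mxE mulrC.
rewrite -[mat bs f]mulmx1 -(mulmxV Hu) mulmxA fH mxtrace_mulC mulmxA mulVmx //.
rewrite mul1mx trace_map_mx mxtrace_tr //.
Qed.

(** * One W-type modules *)

Section OperatorForm.
Variables (R : realType) (V : vectType R) (dot : {dot V for idfun}).
Variables (Phi Phip Pi : seq V) (k : V -> R) (e : seq V).
Hypothesis rootPhi : root_system dot Phi.
Hypothesis posPhip : positive_system dot Phi Phip.
Hypothesis simplePi : simple_roots Phip Pi.
Hypothesis basis_e : basis_of fullv e.
Hypothesis ortho_e : orthonormal dot e.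

Local Notation C := R[i].
Local Notation W := (weyl dot Phi).
Variables (X : lmodType C) (t : W -> {linear X -> X}) (o o' : V -> {linear X -> X}).
Hypothesis t1 : forall x, t (weyl1 dot Phi) x = x.
Hypothesis tM : forall u w x, t (weylM u w) x = t u (t w x).
Hypothesis t_irr : simple_action (fun w => t w).
Hypothesis o_lin : forall (c : R) u v x, o (c *: u + v) x = (c%:C)%C *: o u x + o v x.
Hypothesis o'_lin : forall (c : R) u v x, o' (c *: u + v) x = (c%:C)%C *: o' u x + o' v x.
Hypothesis o_comm : forall u v x, o u (o v x) = o v (o u x).
Hypothesis o_cross : forall a (s : W) v x, a \in Pi -> val s = refl dot a ->
  o v (t s x) = t s (o (refl dot a v) x) + ((k a * (2 * dot a v / dot a a))%:C)%C *: x.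
Hypothesis o'_cross : forall a (s : W) v x, a \in Pi -> val s = refl dot a ->
  t s (o' v x) = o' (refl dot a v) (t s x) + ((k a * (2 * dot a v / dot a a))%:C)%C *: x.
Variable B : {hermitian_sym X for Num.conj_op}.
Hypothesis B_nondeg : forall x, (forall y, B x y = 0) -> x = 0.
Hypothesis B_t : forall w x y, B (t w x) y = B x (t (weylV w) y).
Hypothesis B_o' : forall v x y, B (o' v x) y = B x (o v y).

(** The translates of a nonzero vector under the finite group span a stable subspace, hence all of
    [X]. *)
Lemma irreducible_basis : exists n (b : 'I_n.+1 -> X), spanning b /\
  forall c, \sum_i c i *: b i = 0 -> forall i, c i = 0.
Proof.
have [[x0 x00] irr] := t_irr.
have [ws [wsU wsP]] := weyl_finite rootPhi.
pose b (i : 'I_(size ws)) := t (nth (weyl1 dot Phi) ws i) x0.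
pose U : {pred X} := fun x => `[< exists c : 'I_(size ws) -> C, x = \sum_i c i *: b i >].
have bE w : exists i, t w x0 = b i.
  have iS : (index w ws < size ws)%N by rewrite index_mem.
  by exists (Ordinal iS); rewrite /b /= nth_index.
have U_b i : b i \in U.
  apply/asboolP; exists (fun j => (j == i)%:R); rewrite (bigD1 i) //= eqxx scale1r.
  by rewrite big1 ?addr0 // => j /negPf ->; rewrite scale0r.
have U_sub : submod_closed U.
  split=> [|c x y].
    by apply/asboolP; exists (fun=> 0); rewrite big1 // => i _; rewrite scale0r.
  move=> /asboolP[cx xE] /asboolP[cy yE]; apply/asboolP.
  exists (fun i => c * cx i + cy i); rewrite xE yE scaler_sumr -big_split.
  by apply: eq_bigr => i _; rewrite scalerDl scalerA.
have U_sum (c : 'I_(size ws) -> C) (f : 'I_(size ws) -> X) :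
    (forall i, f i \in U) -> \sum_i c i *: f i \in U.
  move=> fU; have [U0 UP] := U_sub; elim: (index_enum _) => [|i s IH].
    by rewrite big_nil.
  by rewrite big_cons UP.
have b_span : spanning b.
  have [|h|h x] := irr U U_sub; last by have /asboolP := h x.
  - move=> w x /asboolP[c ->]; rewrite linear_sum /=.
    under eq_bigr do rewrite linearZ /=.
    apply: U_sum => i; rewrite /b -tM; have [j ->] := bE (weylM w (nth (weyl1 dot Phi) ws i)).
    exact: U_b.
  - case/eqP: x00; apply: h; have [i iE] := bE (weyl1 dot Phi).
    by rewrite t1 in iE; rewrite iE; apply: U_b.
have [n [b' [bs bf]]] := basis_exists b_span.
case: n b' bs bf => [|n] b' bs bf; last by exists n, b'.
by have [c x0E] := bs x0; rewrite x0E big_ord0 eqxx in x00.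
Qed.

Lemma adjoint_family_eq v x : o v x = o' v x.
Proof.
have [n [b [bs bf]]] := irreducible_basis.
pose M (f : {linear X -> X}) := mat bs f.
have ME (f : {linear X -> X}) y : coords bs (f y) = coords bs y *m M f by exact: matE.
have MC (f g h : {linear X -> X}) : (forall y, h y = f (g y)) -> M h = M g *m M f.
  by move=> hE; apply: mat_unique => // y; rewrite hE !ME mulmxA.
have MI (f : {linear X -> X}) (A : 'M_n.+1) :
    (forall y, coords bs (f y) = coords bs y *m A) -> M f = A by exact: mat_unique.
have Mdef (f : {linear X -> X}) : M f = mat bs f by [].
clearbody M.
(* Row vectors are multiplied on the right: the inverse makes [r] a morphism. *)
pose r (w : W) := M (t (weylV w)).
have rsE (s : W) a : val s = refl dot a -> r s = M (t s).
  by move=> sE; rewrite /r (weyl_reflV rootPhi sE).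
have r1 : r (weyl1 dot Phi) = 1%:M.
  by apply: MI => y; rewrite weyl_inv1 // t1 mulmx1.
have rM u w : r (weylM u w) = r u *m r w.
  by apply: MC => y; rewrite weyl_invM // tM.
suff key : M (o v) = M (o' v).
  have eqc : coords bs (o v x) = coords bs (o' v x) by rewrite !ME key.
  by rewrite -(coordsK bs (o v x)) eqc coordsK.
apply: (@adjoint_family_mx_eq _ _ _ _ _ _ k rootPhi posPhip simplePi _ basis_e ortho_e _ _
  (fun v => M (o v)) r1 rM _ _ _ _ (fun v => M (o' v))).
- move=> U U0 Ustab; have [_ irr] := t_irr.
  pose P : {pred X} := fun y => (coords bs y <= U)%MS.
  have [|w y yU|h|h] := irr P.
  + split=> [|c y z]; rewrite -!topredE /= /P.
      by rewrite coords0 // sub0mx.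
    by move=> yU zU; rewrite coords_lin // addmx_sub // scalemx_sub.
  + move: yU; rewrite -!topredE /= /P ME => yU.
    rewrite -[w](weyl_invK rootPhi).
    exact: submx_trans (submxMr _ yU) (Ustab (weylV w)).
  + suff U00 : U = 0 by rewrite U00 eqxx in U0.
    apply/row_matrixP => i; rewrite row0 -(decodeK bs bf (row i U)).
    have -> : decode b (row i U) = 0.
      by apply: h; rewrite -topredE /= /P decodeK // row_sub.
    exact: coords0.
  + rewrite -sub1mx; apply/row_subP => i.
    by have := h (decode b (row i 1%:M)); rewrite -topredE /= /P decodeK.
- move=> c u z; apply: MI => y; rewrite o_lin coords_lin // !ME.
  by rewrite mulmxDr -scalemxAr.
- move=> u z; rewrite -(MC (o z) (o u) (o z \o o u : {linear X -> X})) //.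
  by rewrite -(MC (o u) (o z) (o z \o o u : {linear X -> X})) // => y; rewrite /= o_comm.
- move=> a s z aP sE; rewrite (rsE s a sE).
  rewrite -(MC (t s) (o z) (t s \o o z : {linear X -> X})) //.
  apply: MI => y; set c := (_%:C)%C.
  (* Products of matrices reverse composition, so [t s] must be outermost: this is [o_cross] at the
     reflected vector, where the scalar changes sign. *)
  have E : t s (o z y) = c *: y + o (refl dot a z) (t s y).
    rewrite (o_cross _ y aP sE) reflK -(refl_dot dot a a z) refl_self dotNl mulrN mulNr mulrN.
    by rewrite rmorphN scaleNr addrCA subrr addr0.
  by rewrite /= E coords_lin // !ME mulmxDr mulmxA mul_mx_scalar addrC.
- move=> c u z; apply: MI => y; rewrite o'_lin coords_lin // !ME.
  by rewrite mulmxDr -scalemxAr.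
- move=> a s z aP sE; rewrite (rsE s a sE).
  rewrite -(MC (t s) (o' z) (t s \o o' z : {linear X -> X})) //.
  apply: MI => y; rewrite /= (o'_cross z y aP sE).
  by rewrite addrC coords_lin // !ME mulmxDr mulmxA mul_mx_scalar addrC.
- move=> w z; rewrite /r [in RHS]mxtrace_mulC.
  rewrite -(MC (o' z) (t (weylV w)) (o' z \o t (weylV w) : {linear X -> X})) //.
  rewrite -(MC (t (weylV (weylV w))) (o z) (t (weylV (weylV w)) \o o z : {linear X -> X})) //.
  rewrite !Mdef; apply: (adjoint_trace bs bf B_nondeg) => y y' /=.
  by rewrite B_o' B_t.
Qed.
End OperatorForm.

Lemma anti_involution_cross (A : pzRingType) (st : A -> A) (t o o' c : A) :
  (forall x y, st (x + y) = st x + st y) ->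
  (forall x y, st (x * y) = st y * st x) -> st t = t -> st c = c ->
  o * t = t * o' + c -> t * st o = st o' * t + c.
Proof.
by move=> stD stM tE cE /(congr1 st); rewrite stD !stM tE cE.
Qed.

Section OneWType.
Variables (R : realType) (V : vectType R) (dot : {dot V for idfun}).
Variables (Phi Phip Pi : seq V) (k : V -> R).
Variables (w0 : weyl dot Phi) (star : hecke dot Phi Pi k -> hecke dot Phi Pi k).
Variables (X : lmodType R[i]) (pi : hecke dot Phi Pi k -> {linear X -> X}).
Variable e : seq V.
Hypothesis rootPhi : root_system dot Phi.
Hypothesis posPhip : positive_system dot Phi Phip.
Hypothesis simplePi : simple_roots Phip Pi.
Hypothesis star_pi : hecke_star w0 star.
Hypothesis basis_e : basis_of fullv e.
Hypothesis ortho_e : orthonormal dot e.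
Hypothesis one_pi : one_W_type star pi.

Local Notation C := R[i].
Local Notation W := (weyl dot Phi).
Local Notation H := (hecke dot Phi Pi k).
Local Notation T w := (heckeT Pi k w : H).
Local Notation Ov v := (heckeO dot Phi Pi k (to_cplx v) : H).

Definition heckeC (c : C) : H := c *: (1 : H).

Lemma heckeT1 : T (weyl1 dot Phi) = 1.
Proof. by apply/presented_eqP/ideal_rel/hecke_T1. Qed.

Lemma heckeTM u w : T u * T w = T (weylM u w).
Proof. by rewrite -presented_classM; apply/presented_eqP/ideal_rel/hecke_TM. Qed.

Lemma heckeO_comm u v : Ov u * Ov v = Ov v * Ov u.
Proof. by rewrite -!presented_classM; apply/presented_eqP/ideal_rel/hecke_OC. Qed.

Lemma heckeO_lin (c : R) u v : Ov (c *: u + v) = (c%:C)%C *: Ov u + Ov v.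
Proof.
have -> : to_cplx (c *: u + v) = (c%:C)%C *: to_cplx u + to_cplx v.
  congr (_, _); rewrite /= ?scaler0 ?scale0r ?subr0 ?addr0 //.
by rewrite -presented_classZ -presented_classD; apply/presented_eqP/ideal_rel/hecke_linear.
Qed.

Lemma hecke_crossE a (s : W) v : a \in Pi -> val s = refl dot a ->
  Ov v * T s = T s * Ov (refl dot a v) +
    heckeC ((k a * (2 * dot a v / dot a a))%:C)%C.
Proof.
move=> aP sE; rewrite -[heckeC _]presented_classZ -!presented_classM -presented_classD.
apply/presented_eqP; rewrite opprD addrA; apply: ideal_rel.
have := hecke_cross k (to_cplx v) aP sE.
have -> : cplx_map (refl dot a) (to_cplx v) = to_cplx (refl dot a v).
  by congr (_, _); rewrite /= linear0.
have -> : dotC dot a (to_cplx v) = ((dot a v)%:C)%C by rewrite /dotC /= linear0r.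
by rewrite !rmorphM fmorphV rmorph_nat.
Qed.

Lemma starE1 : star 1 = 1.
Proof. by rewrite -heckeT1 (starT star_pi) weyl_inv1. Qed.

Lemma star_heckeC (c : R) : star (heckeC ((c%:C)%C)) = heckeC ((c%:C)%C).
Proof.
apply: etrans (starZ star_pi _ _) _; apply: congr2 => //; last exact: starE1.
by apply: conj_Creal; apply/complex_realP; exists c.
Qed.

(** [star] reverses products, and fixes both the simple reflection, an involution, and the scalar,
    which is real. *)
Lemma star_cross a (s : W) v : a \in Pi -> val s = refl dot a ->
  T s * star (Ov v) = star (Ov (refl dot a v)) * T s +
    heckeC ((k a * (2 * dot a v / dot a a))%:C)%C.
Proof.
move=> aP sE.
apply: (anti_involution_cross (starD star_pi) (starM star_pi)).
- by rewrite (starT star_pi) (weyl_reflV rootPhi sE).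
- exact: star_heckeC.
- exact: hecke_crossE.
Qed.

Lemma star_lin (c : R) u v :
  star (Ov (c *: u + v)) = (c%:C)%C *: star (Ov u) + star (Ov v).
Proof.
rewrite heckeO_lin; apply: etrans (starD star_pi _ _) _; apply: congr2 => //.
apply: etrans (starZ star_pi _ _) _; apply: congr2 => //.
by apply: conj_Creal; apply/complex_realP; exists c.
Qed.

Let pi_rep : hecke_module pi. Proof. by case: one_pi. Qed.

(** The hermitian form makes [o' v] adjoint to [o v], and both satisfy the cross relation, so
    [adjoint_family_eq] identifies them. *)
Lemma omega_tilde0 v x : pi (omega_tilde star v) x = 0.
Proof.
have [_ _ [B [nd adj]] t_irr] := one_pi.
pose t w := pi (T w); pose o v := pi (Ov v); pose o' v := pi (star (Ov v)).
have piD g h y : pi (g + h) y = pi g y + pi h y by exact: (actD pi_rep).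
have piZ c g y : pi (c *: g) y = c *: pi g y by exact: (actZ pi_rep).
have piM g h y : pi (g * h) y = pi g (pi h y) by exact: (actM pi_rep).
have piC c y : pi (heckeC c) y = c *: y by rewrite piZ (act1 pi_rep).
have piN g y : pi (- g) y = - pi g y.
  by have := piZ (-1) g y; rewrite !scaleN1r.
have key : o v x = o' v x.
  apply: (@adjoint_family_eq _ _ _ _ _ _ k _ rootPhi posPhip simplePi basis_e ortho_e
    _ t o o' _ _ t_irr _ _ _ _ _ B nd).
  - by move=> y; rewrite /t heckeT1; apply: (act1 pi_rep).
  - by move=> u w y; rewrite /t -heckeTM; apply: piM.
  - move=> c u w y; rewrite /o heckeO_lin; apply: etrans (piD _ _ _) _.
    by congr (_ + _); apply: piZ.
  - move=> c u w y; rewrite /o' star_lin; apply: etrans (piD _ _ _) _.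
    by congr (_ + _); apply: piZ.
  - move=> u w y; rewrite /o; apply: etrans (esym (piM _ _ _)) _.
    by rewrite heckeO_comm; apply: piM.
  - move=> a s u y aP sE; rewrite /o /t; apply: etrans (esym (piM _ _ _)) _.
    rewrite (hecke_crossE u aP sE); apply: etrans (piD _ _ _) _.
    by congr (_ + _); [apply: piM | apply: piC].
  - move=> a s u y aP sE; rewrite /o' /t; apply: etrans (esym (piM _ _ _)) _.
    rewrite (star_cross u aP sE); apply: etrans (piD _ _ _) _.
    by congr (_ + _); [apply: piM | apply: piC].
  - by move=> w y z; rewrite /t adj (starT star_pi).
  - by move=> u y z; rewrite /o' /o adj (starK star_pi).
apply: etrans (piZ _ _ _) _; rewrite piD piN.
by rewrite -/(o v) -/(o' v) key subrr scaler0.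
Qed.

End OneWType.

Theorem proposition3p3p1 (R : realType) (V : vectType R)
    (dot : {dot V for idfun}) (Phi Phip Pi : seq V) (k : V -> R)
    (w0 : weyl dot Phi) (star : hecke dot Phi Pi k -> hecke dot Phi Pi k)
    (e : seq V) (X S : lmodType R[i])
    (pi : hecke dot Phi Pi k -> {linear X -> X})
    (gam : clifford dot -> {linear S -> S}) :
  root_system dot Phi ->
  positive_system dot Phi Phip ->
  simple_roots Phip Pi ->
  weyl_invariant dot Phi Phip k ->
  longest Pi w0 ->
  hecke_star w0 star ->
  basis_of fullv e -> orthonormal dot e ->
  spin_module gam ->
  one_W_type star pi ->
  exists phi :
      {linear dirac_cohomology star pi gam e -> tensor X S},
    bijective phi /\
    forall y : ker (dirac star pi gam e), phi (cohomology_class y) = val y.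
Proof.
move=> rootPhi posPhip simplePi _ _ star_pi basis_e ortho_e _ one_pi.
(* Every summand of the Dirac operator has a zero left factor, so the operator vanishes. *)
apply: zero_cohomology => z; apply: big1 => v _; apply: tensor_map0l => x.
exact: omega_tilde0 rootPhi posPhip simplePi star_pi basis_e ortho_e one_pi v x.
Qed.
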